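(* Let $\sigma>0$, $c_k=(2\pi|k|)^{\sigma}$ for $k\in\mathbb{Z}$ (Sobolev case), let $d=d_\varepsilon\to\infty$ as $\varepsilon\to0$ with $\log d=o(\varepsilon^{-2/(2\sigma+1)})$, and let $s=s_\varepsilon\in\{1,\dots,d\}$ be such that $s=o(d)$. Assume that $r_\varepsilon=r_\varepsilon(s)>0$ satisfies $$\limsup_{\varepsilon\to0}\frac{u_\varepsilon(r_\varepsilon)}{\sqrt{2\log(d/s)}}<1 .$$ Then $$\liminf_{\varepsilon\to0}\ \inf_{\tilde\eta}\ \sup_{\eta\in\mathcal{H}_{d,s}}\ \sup_{\theta\in\Theta_{\sigma,d}(r_\varepsilon)} s^{-1}\,\mathbf{E}_{\eta,\theta}|\eta-\tilde\eta|>0,$$ where the infimum is over all selectors $\tilde\eta$, i.e. all measurable functions of the observations $(X_{j,k})_{1\le j\le d,\,k\in\mathbb{Z}}$ with values in $\{0,1\}^d$.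
   Context: Model. For noise level $\varepsilon>0$ and dimension $d=d_\varepsilon$ one observes $X_{j,k}=\eta_j\theta_{j,k}+\varepsilon\xi_{j,k}$, $1\le j\le d$, $k\in\mathbb{Z}$, with $\xi_{j,k}$ i.i.d. $N(0,1)$. Expectation under this model is $\mathbf{E}_{\eta,\theta}$. Here $\eta\in\mathcal{H}_{d,s}=\{\eta\in\{0,1\}^d:\sum_{j=1}^d\eta_j=s\}$ and $\theta=(\theta_1,\dots,\theta_d)$ with $\theta_j=(\theta_{j,k})_{k\in\mathbb{Z}}$. For $a,b\in\{0,1\}^d$, $|a-b|=\sum_{j=1}^d|a_j-b_j|$ is the Hamming distance. Parameter sets. For $r>0$, $$\Theta_\sigma(r)=\Big\{\vartheta=(\vartheta_k)_{k\in\mathbb{Z}}\in l_2(\mathbb{Z}):\ \vartheta_0=0,\ \sum_{k}c_k^2\vartheta_k^2\le1,\ \sum_k\vartheta_k^2\ge r^2\Big\},$$ and $\Theta_{\sigma,d}(r)=\{\theta=(\theta_1,\dots,\theta_d):\theta_j\in\Theta_\sigma(r),\ 1\le j\le d\}$. The function $u_\varepsilon(r)\ge0$ is defined by $u_\varepsilon^2(r)=\frac{1}{2\varepsilon^4}\inf_{\vartheta\in\Theta_\sigma(r)}\sum_{k}\vartheta_k^4$ (with $\inf\emptyset=+\infty$). *)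

(* Defs.v *)
From HB Require Import structures.
From mathcomp Require Import all_boot all_order all_algebra finmap.
From mathcomp Require Import all_classical all_reals all_analysis.
Set Implicit Arguments.
Unset Strict Implicit.
Unset Printing Implicit Defensive.
Import Order.TTheory GRing.Theory Num.Theory.
Import numFieldNormedType.Exports.
Local Open Scope classical_set_scope.
Local Open Scope ring_scope.

Definition mutually_independent (R : realType) (disp : measure_display)
    (T : measurableType disp) (P : probability T R) (I : choiceType)
    (X : I -> {RV P >-> R}) : Prop :=
  forall (J : {fset I}) (B : I -> set R),
    (forall i, measurable (B i)) ->
    P (\bigcap_(i in [set` J]) (X i @^-1` B i)) =
    (\prod_(i <- J) P (X i @^-1` B i))%E.

(* A probability space carrying i.i.d. N(0,1) variables indexed by
   {1..d} x Z.  The law of the observations, hence the minimax risk below,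
   does not depend on which such space is chosen. *)
Record gaussian_noise (R : realType) (d : nat) := GaussianNoise {
  noise_disp : measure_display;
  noise_space : measurableType noise_disp;
  noise_prob : probability noise_space R;
  noise_var : 'I_d * int -> {RV noise_prob >-> R};
  noise_law : forall (jk : 'I_d * int) (A : set R), measurable A ->
    distribution noise_prob (noise_var jk) A = normal_prob 0 1 A;
  noise_indep : mutually_independent noise_var
}.

Section model.
Context {R : realType}.

Definition sobolev_coef (sigma : R) (k : int) : R :=
  (2 * pi * `|k|%:~R) `^ sigma.

Local Open Scope ereal_scope.

Definition Theta (sigma r : R) : set (int -> R) :=
  [set v | [/\ \esum_(k in [set: int]) ((v k ^+ 2)%R)%:E < +oo,
               v 0%R = 0%R,
               \esum_(k in [set: int])
                 ((sobolev_coef sigma k ^+ 2 * v k ^+ 2)%R)%:E <= 1 &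
               ((r ^+ 2)%R)%:E <= \esum_(k in [set: int]) ((v k ^+ 2)%R)%:E]].

Definition Theta_d (sigma : R) (d : nat) (r : R) : set ('I_d -> int -> R) :=
  [set theta | forall j, Theta sigma r (theta j)].

(* For eps > 0 it is +oo when Theta sigma r is empty (ereal_inf set0). *)
Definition u_fun (sigma eps r : R) : \bar R :=
  sqrte (((2 * eps ^+ 4)^-1)%R%:E *
         ereal_inf [set \esum_(k in [set: int]) ((v k ^+ 4)%R)%:E
                   | v in Theta sigma r]).

Definition hypercube_s (d s : nat) : set (d.-tuple bool) :=
  [set eta | (\sum_(j < d) nat_of_bool (tnth eta j))%N = s].

Definition hamming (d : nat) (a b : d.-tuple bool) : R :=
  (\sum_(j < d) `|(tnth a j)%:R - (tnth b j)%:R|)%R.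

Definition cylinders (d : nat) : set (set ('I_d -> int -> R)) :=
  [set C | exists (j : 'I_d) (k : int) (B : set R),
     measurable B /\ C = [set x | B (x j k)]].

(* R^({1..d} x Z) with its product sigma-algebra. *)
Definition obs_space (d : nat) := g_sigma_algebraType (@cylinders d).

Definition selectors (d : nat) : set (obs_space d -> d.-tuple bool) :=
  [set sel | measurable_fun [set: obs_space d] sel].

Definition observation (d : nat) (N : gaussian_noise R d) (eps : R)
    (eta : d.-tuple bool) (theta : 'I_d -> int -> R) (w : noise_space N) :
    obs_space d :=
  fun j k => ((tnth eta j)%:R * theta j k + eps * noise_var N (j, k) w)%R.

Definition expected_loss (d : nat) (N : gaussian_noise R d) (eps : R)
    (eta : d.-tuple bool) (theta : 'I_d -> int -> R)
    (sel : obs_space d -> d.-tuple bool) : \bar R :=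
  'E_(noise_prob N)[fun w => hamming eta (sel (observation eps eta theta w))].

Definition minimax_risk (sigma : R) (d : nat) (N : gaussian_noise R d)
    (eps : R) (s : nat) (r : R) : \bar R :=
  ereal_inf [set
    ereal_sup [set
      ereal_sup [set (s%:R^-1)%R%:E * expected_loss N eps eta theta sel
                | theta in @Theta_d sigma d r]
    | eta in @hypercube_s d s]
  | sel in @selectors d].

End model.

(* Main.v *)
Require Import Defs.
From HB Require Import structures.
From mathcomp Require Import all_boot all_order all_algebra finmap.
From mathcomp Require Import all_classical all_reals all_analysis.
From mathcomp Require Import measurable_realfun ring lra.
Set Implicit Arguments.
Unset Strict Implicit.
Unset Printing Implicit Defensive.
Import Order.TTheory GRing.Theory Num.Theory.
Import numFieldNormedType.Exports.
Local Open Scope classical_set_scope.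
Local Open Scope ring_scope.

(** Write l = log (d/s).  The assumption on r supplies, for small eps, a signal
    v in the class Theta with sum_k (v_k / eps)^4 / 4 < rho * l for a fixed
    rho < 1, and the claim is that signals this weak cannot be located.

    Least favourable prior.  Split s * m of the d coordinates, m = d %/ s,
    into s blocks of m coordinates.  Independently in each block, choose the
    active coordinate uniformly and give it the signal (+-v_k)_k with
    independent uniform signs.  Every realization lies in the parameter set,
    because Theta only depends on the squares, and has exactly s active
    coordinates.  Conditionally on the other blocks, the problem in one block
    is to name one out of m hypotheses, and a wrong answer costs at least one
    unit of Hamming loss (hamming_blocks).

    Fano's inequality.  Let L be the likelihood ratio of a hypothesis against
    pure noise and E the event that the selector names that hypothesis.
    Integrating L * y <= L log L - L + e^y with y = (log m) 1_E against pure
    noise gives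
      (log m) P_1(E) <= KL + (m - 1) P_0(E),
    and the m events are disjoint, so that the average success probability is
    at most (KL + 1) / log m (likelihood_ratio_fano, fano_block).

    Information of the random signs.  Put a_k = v_k / eps.  By independence
    KL is the sum over k of the divergences of the mixtures of N(a_k, 1) and
    N(-a_k, 1) from N(0, 1), and the heart of the proof is that each of these
    is at most a_k^4 / 4 for every real a_k (lncosh_mean_le).  This is the sharp
    constant: comparing with the second moment of L would lose a factor 2 and
    the threshold sqrt (2 log (d/s)) with it.  Hence KL < rho * l, whereas
    log m >= l - 1, and the success probability stays below 1 by a margin that
    does not depend on eps.

    Two reductions make likelihood ratios finite products.  Near-optimal
    signals may be taken with finite support, by moving the energy of the tail
    to the lowest frequency, where it costs the least smoothness
    (Theta_finite_support).  And the Cameron-Martin formula is first proved for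
    a shift of one coordinate of the infinite family of observations
    (cameron_martin1), by comparing two measures on finite-dimensional boxes,
    and then iterated. *)


(** * Measures with a density *)

Section nonnegative_real_integrals.
Context d (T : measurableType d) (R : realType).
Variable mu : {measure set T -> \bar R}.
Local Open Scope ereal_scope.
Implicit Types f g : T -> R.

Lemma integralD_ge0R f g :
  measurable_fun [set: T] f -> measurable_fun [set: T] g ->
  (forall x, (0 <= f x)%R) -> (forall x, (0 <= g x)%R) ->
  \int[mu]_x (f x + g x)%:E = \int[mu]_x (f x)%:E + \int[mu]_x (g x)%:E.
Proof.
move=> mf mg f0 g0; rewrite -(@ge0_integralD _ _ _ mu setT)//.
all: by [exact/measurable_EFinP | move=> x _; rewrite lee_fin].
Qed.

Lemma integralZ_ge0R k f : (0 <= k)%R ->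
  measurable_fun [set: T] f -> (forall x, (0 <= f x)%R) ->
  \int[mu]_x (k * f x)%:E = k%:E * \int[mu]_x (f x)%:E.
Proof.
move=> k0 mf f0; rewrite -(@ge0_integralZl _ _ _ mu setT)//.
all: by [exact/measurable_EFinP | move=> x _; rewrite lee_fin].
Qed.

Lemma integral_sum_ge0R (I : Type) (s : seq I) (f : I -> T -> R) :
  (forall i, measurable_fun [set: T] (f i)) -> (forall i x, (0 <= f i x)%R) ->
  \int[mu]_x (\sum_(i <- s) f i x)%:E =
  \sum_(i <- s) \int[mu]_x (f i x)%:E.
Proof.
move=> mf f0; under eq_integral do rewrite -sumEFin.
rewrite ge0_integral_sum//.
all: by [move=> i; exact/measurable_EFinP | move=> i x _; rewrite lee_fin].
Qed.

Lemma le_integral_ge0R f g :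
  measurable_fun [set: T] f -> measurable_fun [set: T] g ->
  (forall x, (0 <= f x)%R) -> (forall x, (f x <= g x)%R) ->
  \int[mu]_x (f x)%:E <= \int[mu]_x (g x)%:E.
Proof.
move=> mf mg f0 fg; apply: ge0_le_integral => //.
all: by [exact/measurable_EFinP | move=> x _; rewrite lee_fin].
Qed.

Lemma integral_ge0R f : (forall x, (0 <= f x)%R) -> 0 <= \int[mu]_x (f x)%:E.
Proof. by move=> f0; apply: integral_ge0 => x _; rewrite lee_fin. Qed.

End nonnegative_real_integrals.

Section density.
Context d (T : measurableType d) (R : realType).
Variable mu : {measure set T -> \bar R}.
Variable h : T -> R.
Hypothesis h0 : forall x, 0 <= h x.
Hypothesis mh : measurable_fun [set: T] h.
Local Open Scope ereal_scope.
Import HBNNSimple.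

Let mhE : measurable_fun [set: T] (fun x => (h x)%:E).
Proof. exact/measurable_EFinP. Qed.

(** Both sides are monotone limits along the same increasing simple functions,
    so that the hypothesis on sets is enough. *)
Lemma ge0_integral_density (nu : {measure set T -> \bar R}) (f : T -> \bar R) :
  (forall A, measurable A -> nu A = \int[mu]_(x in A) (h x)%:E) ->
  measurable_fun [set: T] f -> (forall x, 0 <= f x) ->
  \int[nu]_x f x = \int[mu]_x (f x * (h x)%:E).
Proof.
move=> nuE mf f0; pose g := nnsfun_approx measurableT mf.
have gf x : (EFin \o g n) x @[n --> \oo] --> f x.
  by apply: cvg_nnsfun_approx => // *; exact: f0.
have -> : \int[nu]_x f x = limn (fun n => \int[nu]_x (EFin \o g n) x).
  under eq_integral => x _ do rewrite -(cvg_lim _ (gf x))//.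
  apply: monotone_convergence => //.
  - by move=> n; apply/measurable_EFinP.
  - by move=> n x _ /=; rewrite lee_fin.
  - by move=> x _ a b ab; rewrite lee_fin; exact/lefP/nd_nnsfun_approx.
have -> : \int[mu]_x (f x * (h x)%:E) =
    limn (fun n => \int[mu]_x ((g n x)%:E * (h x)%:E)).
  have gfh x : (EFin \o g n) x * (h x)%:E @[n --> \oo] --> f x * (h x)%:E.
    exact: cvgeZr.
  under eq_integral => x _ do rewrite -(cvg_lim _ (gfh x))//.
  apply: monotone_convergence => //.
  - by move=> n; apply: emeasurable_funM => //; apply/measurable_EFinP.
  - by move=> n x _ /=; rewrite -EFinM lee_fin mulr_ge0.
  - move=> x _ a b ab /=; rewrite lee_wpmul2r ?lee_fin//.
    exact/lefP/nd_nnsfun_approx.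
congr (limn _); apply/funext => n; set k := g n.
have mk r : measurable_fun [set: T] (fun x => (r * \1_(k @^-1` [set r]) x)%:E).
  by apply/measurable_EFinP; exact: measurable_funM.
have k0 r x : 0 <= (r * \1_(k @^-1` [set r]) x)%:E.
  exact: (nnfun_muleindic_ge0 k).
transitivity (\int[nu]_x
   (\sum_(y \in range k) (y * \1_(k @^-1` [set y]) x)%:E)).
  by apply: eq_integral => x _; rewrite /= (fimfunE k) -fsumEFin.
rewrite ge0_integral_fsum//.
transitivity (\int[mu]_x (\sum_(y \in range k)
    ((y * \1_(k @^-1` [set y]) x)%:E * (h x)%:E))).
  rewrite ge0_integral_fsum//.
  2: by move=> y; exact: emeasurable_funM.
  2: by move=> y x _; apply: mule_ge0 => //; rewrite lee_fin.
  apply: eq_fsbigr => r; rewrite inE => -[t _ rE].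
  have r0 : (0 <= r)%R by rewrite -rE.
  under eq_integral do rewrite EFinM.
  under [RHS]eq_integral do rewrite EFinM -muleA.
  rewrite !ge0_integralZl//; last 3 first.
  - by apply: emeasurable_funM => //; apply/measurable_EFinP.
  - by move=> x _; apply: mule_ge0; rewrite lee_fin.
  - by apply/measurable_EFinP.
  congr (_ * _); rewrite integral_indic// setIT nuE//.
  rewrite integral_mkcond; apply: eq_integral => x _.
  by rewrite epatch_indic muleC.
apply: eq_integral => x _; rewrite -ge0_mule_fsuml//.
by rewrite fsumEFin// -(fimfunE k).
Qed.

(** The two proofs are arguments so that the term itself carries a measure
    structure. *)
Definition density (_ : forall x, (0 <= h x)%R) (_ : measurable_fun [set: T] h)
  (A : set T) := \int[mu]_(x in A) (h x)%:E.

Local Notation dens := (density h0 mh).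

Let density0 : dens set0 = 0. Proof. by rewrite /density integral_set0. Qed.

Let density_ge0 A : 0 <= dens A.
Proof. by apply: integral_ge0 => x _; rewrite lee_fin. Qed.

Let density_additive : semi_sigma_additive dens.
Proof.
move=> F mF tF mUF; rewrite /density ge0_integral_bigcup//; last 2 first.
  exact: measurable_funTS.
  by move=> x _; rewrite lee_fin.
apply: is_cvg_ereal_nneg_natsum_cond => n _ _.
by apply: integral_ge0 => x _; rewrite lee_fin.
Qed.

HB.instance Definition _ := isMeasure.Build _ _ _ dens
  density0 density_ge0 density_additive.

End density.

(** * The standard normal law *)

Section gauss.
Context {R : realType}.
Local Open Scope ereal_scope.
Local Notation leb := (@lebesgue_measure R).
Local Notation gamma := (normal_prob (0 : R) 1).

Lemma lebesgue_measureD (a : R) (A : set R) : measurable A ->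
  pushforward leb ((fun x => x + a)%R : _ -> measurableTypeR R) A = leb A.
Proof.
move=> mA; apply/esym; apply: lebesgue_measure_unique => //.
  exact: measurable_funD.
move=> /= _ _ [[b c]] _ <-.
rewrite /pushforward.
have -> : (fun x => x + a)%R @^-1` `]b, c]%classic = `](b - a)%R, (c - a)%R]%classic.
  by apply/seteqP; split => x /=; rewrite !in_itv/= ltrBlDr lerBrDr.
rewrite !lebesgue_measure_itv/= !lte_fin ltrD2r; case: ifP => // _.
by rewrite -!EFinB; congr EFin; ring.
Qed.

Lemma ge0_integral_lebesgueD (f : R -> \bar R) (a : R) :
  measurable_fun [set: R] f -> (forall x, 0 <= f x) ->
  \int[leb]_x f (x + a)%R = \int[leb]_x f x.
Proof.
move=> mf f0.
have mD : measurable_fun [set: measurableTypeR R]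
    ((fun x => x + a)%R : measurableTypeR R -> measurableTypeR R).
  exact: measurable_funD.
have := ge0_integral_pushforward mD leb measurableT mf.
rewrite preimage_setT => <- //.
by apply: eq_measure_integral => A mA _; exact: lebesgue_measureD.
Qed.

Lemma ge0_integral_lebesgueN (f : R -> \bar R) :
  measurable_fun [set: R] f -> (forall x, 0 <= f x) ->
  \int[leb]_x f (- x)%R = \int[leb]_x f x.
Proof.
move=> mf f0.
have mN : measurable_fun [set: measurableTypeR R]
    ((fun x => - x)%R : measurableTypeR R -> measurableTypeR R).
  exact: measurableT_comp.
have := ge0_integral_pushforward mN leb measurableT mf.
rewrite preimage_setT => <- //.
by apply: eq_measure_integral => A mA _; exact: lebesgue_measureN.
Qed.

Lemma ge0_integral_normal (f : R -> \bar R) :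
  measurable_fun [set: R] f -> (forall x, 0 <= f x) ->
  \int[gamma]_x f x = \int[leb]_x (f x * (normal_pdf 0 1 x)%:E).
Proof.
move=> mf f0; apply: ge0_integral_density => //.
- exact: normal_pdf_ge0.
- exact: measurable_normal_pdf.
Qed.

Lemma normal_pdf01 (x : R) :
  normal_pdf 0 1 x = (normal_peak 1 * expR (- (x ^+ 2 / 2)))%R.
Proof.
by rewrite normal_pdfE ?oner_neq0// /normal_fun subr0 expr1n mulNr.
Qed.

Lemma normal_reflection (f : R -> \bar R) :
  measurable_fun [set: R] f -> (forall x, 0 <= f x) ->
  \int[gamma]_x f (- x)%R = \int[gamma]_x f x.
Proof.
move=> mf f0.
have mfN : measurable_fun [set: R] (fun x => f (- x)%R).
  exact: measurableT_comp.
pose g (x : R) := f x * (normal_pdf 0 1 x)%:E.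
have mg : measurable_fun [set: R] g.
  apply: emeasurable_funM => //; apply/measurable_EFinP.
  exact: measurable_normal_pdf.
have g0 x : 0 <= g x by rewrite mule_ge0// lee_fin normal_pdf_ge0.
rewrite (ge0_integral_normal mf f0).
rewrite (ge0_integral_normal mfN (fun x => f0 (- x)%R)).
have := ge0_integral_lebesgueN mg g0; rewrite /g => <-.
by apply: eq_integral => x _; rewrite !normal_pdf01 sqrrN.
Qed.

(** Completing the square: the N(a, 1) density is exp(a x - a^2/2) times the
    N(0, 1) density. *)
Lemma normal_shift (f : R -> \bar R) (a : R) :
  measurable_fun [set: R] f -> (forall x, 0 <= f x) ->
  \int[gamma]_x f (x + a)%R =
  \int[gamma]_x (f x * (expR (a * x - a ^+ 2 / 2))%:E).
Proof.
move=> mf f0.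
have mfa : measurable_fun [set: R] (fun x => f (x + a)%R).
  by apply: measurableT_comp => //; exact: measurable_funD.
have me : measurable_fun [set: R] (fun x => (expR (a * x - a ^+ 2 / 2))%:E).
  apply/measurable_EFinP; apply: measurableT_comp => //.
  by apply: measurable_funB => //; exact: measurable_funM.
rewrite !ge0_integral_normal//; last 2 first.
- exact: emeasurable_funM.
- by move=> x; rewrite mule_ge0// lee_fin expR_ge0.
rewrite -[RHS](@ge0_integral_lebesgueD (fun x => f x *
  (expR (a * x - a ^+ 2 / 2))%:E * (normal_pdf 0 1 x)%:E) a)//; last 2 first.
- apply: emeasurable_funM; first exact: emeasurable_funM.
  by apply/measurable_EFinP; exact: measurable_normal_pdf.
- move=> x; rewrite mule_ge0 ?lee_fin ?normal_pdf_ge0//.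
  by rewrite mule_ge0 // lee_fin expR_ge0.
apply: eq_integral => x _; rewrite -muleA; congr (_ * _).
rewrite -EFinM !normal_pdf01 mulrCA -expRD; congr (_ * expR _)%:E.
by field.
Qed.

(** Turns the one-sided exponentials produced by [normal_shift] into
    hyperbolic functions. *)
Lemma normal_symmetrize (f : R -> R) :
  measurable_fun [set: R] f -> (forall x, (0 <= f x)%R) ->
  \int[gamma]_x (f x)%:E = \int[gamma]_x ((f x + f (- x)) / 2)%:E.
Proof.
move=> mf f0.
have mfE : measurable_fun [set: R] (fun x => (f x)%:E) by exact/measurable_EFinP.
have mfNE : measurable_fun [set: R] (fun x => (f (- x))%:E).
  by apply/measurable_EFinP; exact: measurableT_comp.
under [RHS]eq_integral do rewrite mulrC EFinM EFinD.
rewrite ge0_integralZl//; last 2 first.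
- exact: emeasurable_funD.
- by move=> x _; rewrite -EFinD lee_fin addr_ge0.
rewrite ge0_integralD//; last 2 first.
- by move=> x _; rewrite lee_fin.
- by move=> x _; rewrite lee_fin.
rewrite (@normal_reflection (fun x => (f x)%:E))//.
pose I := \int[gamma]_x (f x)%:E; change (I = (2^-1)%:E * (I + I)).
have I0 : 0 <= I by apply: integral_ge0 => x _; rewrite lee_fin.
rewrite ge0_muleDr// -ge0_muleDl ?lee_fin ?invr_ge0// -EFinD.
by rewrite (_ : 2^-1 + 2^-1 = 1 :> R)%R ?mul1e//; field.
Qed.

End gauss.

(** * Hyperbolic functions *)

Section hyperbolic.
Context {R : realType}.
Implicit Types x y : R.

Definition cosh x : R := (expR x + expR (- x)) / 2.
Definition sinh x : R := (expR x - expR (- x)) / 2.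
Definition tanh x : R := sinh x / cosh x.
Definition lncosh x : R := ln (cosh x).

Lemma cosh_ge1 x : 1 <= cosh x.
Proof.
have := expR_ge1Dx x; have := expR_ge1Dx (- x); rewrite /cosh; lra.
Qed.

Lemma cosh_gt0 x : 0 < cosh x.
Proof. exact: lt_le_trans (cosh_ge1 x). Qed.

Lemma lncosh_ge0 x : 0 <= lncosh x.
Proof. by rewrite ln_ge0// cosh_ge1. Qed.

Lemma coshN x : cosh (- x) = cosh x.
Proof. by rewrite /cosh opprK addrC. Qed.

Lemma sinhN x : sinh (- x) = - sinh x.
Proof. by rewrite /sinh opprK; field. Qed.

Lemma tanhN x : tanh (- x) = - tanh x.
Proof. by rewrite /tanh coshN sinhN mulNr. Qed.

Lemma lncoshN x : lncosh (- x) = lncosh x.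
Proof. by rewrite /lncosh coshN. Qed.

Lemma tanh_cosh x : tanh x * cosh x = sinh x.
Proof. by rewrite /tanh divfK// gt_eqF// cosh_gt0. Qed.

Lemma expR_coshsinh x : expR x = cosh x + sinh x.
Proof. by rewrite /cosh /sinh; field. Qed.

Lemma sinh0 : sinh 0 = 0.
Proof. by rewrite /sinh oppr0 subrr mul0r. Qed.

Lemma sinh_ge0 x : 0 <= x -> 0 <= sinh x.
Proof.
by move=> x0; rewrite /sinh divr_ge0// subr_ge0 ler_expR; lra.
Qed.

Lemma le_cosh x y : 0 <= x -> x <= y -> cosh x <= cosh y.
Proof.
move=> x0 xy; rewrite /cosh ler_pM2r//.
have xyE : expR y = expR x * expR (y - x) by rewrite -expRD; congr expR; ring.
have xyN : expR (- y) = expR (- x) * expR (- (y - x)).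
  by rewrite -expRD; congr expR; ring.
have h1 : 1 <= expR (y - x) by rewrite -expR0 ler_expR subr_ge0.
have h2 : expR (- x) <= expR x by rewrite ler_expR; lra.
have h3 : expR (y - x) * expR (- (y - x)) = 1 by rewrite -expRD subrr expR0.
have h4 : 0 < expR (- (y - x)) by exact: expR_gt0.
have h5 : 0 < expR (- x) by exact: expR_gt0.
rewrite xyE xyN; set u := expR (y - x) in h1 h3 *.
set v := expR (- (y - x)) in h3 h4 *.
have v1 : v <= 1 by nra.
have : 2 <= u + v by nra.
nra.
Qed.

Lemma sinh_le x : 0 <= x -> sinh x <= x * cosh x.
Proof.
rewrite le_eqVlt => /predU1P[<-|x0].
  by rewrite sinh0 mul0r.
have dsinh (z : R) : is_derive z 1 sinh (cosh z).
  rewrite /sinh; apply: is_derive_eq.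
  by rewrite /cosh /GRing.scale /=; field.
have [] := @MVT R sinh cosh 0 x x0 (fun z _ => dsinh z).
  apply: continuous_subspaceT => z.
  by apply/differentiable_continuous/derivable1_diffP; case: (dsinh z).
move=> c; rewrite in_itv/= => /andP[c0 cx].
rewrite subr0 => sE; have -> : sinh x = cosh c * x.
  by rewrite -sE sinh0 subr0.
by rewrite mulrC ler_pM2l//; apply: le_cosh; exact: ltW.
Qed.

(** Reduces by parity to tanh x <= x for x >= 0. *)
Lemma tanh_sinh_le x : tanh x * sinh x <= x * sinh x.
Proof.
wlog x0 : x / 0 <= x => [hw|].
  have [/hw//|x0] := leP 0 x.
  have := hw (- x); rewrite tanhN sinhN !mulrNN; apply.
  by rewrite oppr_ge0 ltW.
rewrite ler_wpM2r// ?sinh_ge0//.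
by rewrite /tanh ler_pdivrMr ?cosh_gt0// sinh_le.
Qed.

Lemma tanh_geN1 x : - 1 <= tanh x.
Proof.
rewrite /tanh ler_pdivlMr ?cosh_gt0// /cosh /sinh.
by have := expR_gt0 x; lra.
Qed.

Lemma x_tanh_ge0 x : 0 <= x * tanh x.
Proof.
wlog x0 : x / 0 <= x => [hw|].
  have [/hw//|x0] := leP 0 x.
  by have := hw (- x); rewrite tanhN mulrNN; apply; rewrite oppr_ge0 ltW.
by rewrite mulr_ge0// divr_ge0 ?sinh_ge0// ltW// cosh_gt0.
Qed.

(** Convexity of log cosh, whose derivative is tanh: write cosh x / cosh y as a
    mean of exp(x - y) and exp(y - x) with weights (1 +- tanh y) / 2 and apply
    Jensen's inequality for exp. *)
Lemma lncosh_tangent x y : lncosh y <= lncosh x + tanh y * (y - x).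
Proof.
rewrite -lerBlDr -mulrN opprB.
have pos z : cosh z \in Num.pos by rewrite posrE cosh_gt0.
set c := tanh y * (x - y).
have -> : lncosh y + c = ln (cosh y * expR c).
  by rewrite lnM ?expRK// posrE expR_gt0.
rewrite ler_ln ?posrE ?cosh_gt0 ?(mulr_gt0 (cosh_gt0 _) (expR_gt0 _))//.
have shiftE u : expR c * (1 + u - c) <= expR u.
  have -> : expR u = expR c * expR (u - c) by rewrite -expRD; congr expR; ring.
  by rewrite ler_pM2l ?expR_gt0// -addrA expR_ge1Dx.
have xE : cosh x =
    (expR y * expR (x - y) + expR (- y) * expR (y - x)) / 2.
  by rewrite /cosh -!expRD; congr ((expR _ + expR _) / 2); ring.
have yE : expR y / 2 * (1 + (x - y) - c) + expR (- y) / 2 * (1 + (y - x) - c) =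
    cosh y.
  have -> : expR y = cosh y + sinh y by rewrite expR_coshsinh.
  have -> : expR (- y) = cosh y - sinh y.
    by rewrite expR_coshsinh coshN sinhN.
  by rewrite /c -(tanh_cosh y); field.
rewrite -yE xE.
have := shiftE (x - y); have := shiftE (y - x).
have := expR_gt0 y; have := expR_gt0 (- y).
set P := expR y; set Q := expR (- y); set E := expR c.
set U := expR (x - y); set V := expR (y - x) => Q0 P0 h1 h2.
have : P * (E * (1 + (x - y) - c)) <= P * U by rewrite ler_pM2l.
have : Q * (E * (1 + (y - x) - c)) <= Q * V by rewrite ler_pM2l.
by lra.
Qed.

Lemma measurable_cosh : measurable_fun [set: R] cosh.
Proof.
apply: measurable_funM => //; apply: measurable_funD => //.
by apply: measurableT_comp => //; exact: measurableT_comp.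
Qed.

Lemma measurable_sinh : measurable_fun [set: R] sinh.
Proof.
apply: measurable_funM => //; apply: measurable_funB => //.
by apply: measurableT_comp => //; exact: measurableT_comp.
Qed.

Lemma measurable_lncosh : measurable_fun [set: R] lncosh.
Proof. by apply: measurableT_comp => //; exact: measurable_cosh. Qed.

Lemma measurable_tanh : measurable_fun [set: R] tanh.
Proof.
rewrite (_ : tanh = fun x => sinh x * expR (- lncosh x)).
  apply: measurable_funM; first exact: measurable_sinh.
  apply: measurableT_comp => //; apply: measurableT_comp => //.
  exact: measurable_lncosh.
apply/funext => x; rewrite /tanh expRN lnK// posrE.
exact: cosh_gt0.
Qed.

End hyperbolic.

(** * The information of a random sign in Gaussian noise *)

Section lncosh_mean.
Context {R : realType}.
Local Notation gamma := (normal_prob (0 : R) 1).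
Implicit Types a b : R.

Lemma measurable_affine a b : measurable_fun [set: R] (fun x => a * x + b).
Proof. by apply: measurable_funD => //; exact: measurable_funM. Qed.

Lemma measurable_scale a : measurable_fun [set: R] (fun x => a * x).
Proof. exact: measurable_funM. Qed.

Lemma measurable_expRZ a : measurable_fun [set: R] (fun x => expR (a * x)).
Proof. by apply: measurableT_comp => //; exact: measurable_scale. Qed.

Lemma normal_shift_sym (f : R -> R) b :
  measurable_fun [set: R] f -> (forall x, 0 <= f x) ->
  (\int[gamma]_x (f (x + b))%:E = \int[gamma]_x
    (expR (- (b ^+ 2 / 2)) *
     ((f x * expR (b * x) + f (- x) * expR (- (b * x))) / 2))%:E)%E.
Proof.
move=> mf f0; rewrite (@normal_shift _ (fun x => (f x)%:E))//;
  last exact/measurable_EFinP.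
rewrite (_ : (fun x => _) = fun x => (f x * expR (b * x - b ^+ 2 / 2))%:E)//.
rewrite (@normal_symmetrize _ (fun x => f x * expR (b * x - b ^+ 2 / 2))).
- apply: eq_integral => x _; congr EFin.
  by rewrite mulrN !expRD; field.
- apply: measurable_funM => //; apply: measurableT_comp => //.
  exact: measurable_affine.
- by move=> x; rewrite mulr_ge0// expR_ge0.
Qed.

Lemma normal_cst (c : R) : (\int[gamma]_x c%:E = c%:E)%E.
Proof.
rewrite (integral_cst _ measurableT) [X in (_ * X)%E](_ : _ = 1%E) ?mule1//.
exact: probability_setT.
Qed.

Lemma normal_cosh b : (\int[gamma]_x (cosh (b * x))%:E = (expR (b ^+ 2 / 2))%:E)%E.
Proof.
have mc : measurable_fun [set: R] (fun x => (cosh (b * x))%:E).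
  apply/measurable_EFinP; apply: measurableT_comp; first exact: measurable_cosh.
  exact: measurable_scale.
have := @normal_shift_sym (cst 1) b (measurable_cst _) (fun _ => ler01).
rewrite normal_cst.
under eq_integral do rewrite /= !mul1r EFinM -/(cosh _).
rewrite ge0_integralZl//; last first.
  by move=> x _; rewrite lee_fin ltW// cosh_gt0.
move/(congr1 (fun y => (expR (b ^+ 2 / 2))%:E * y)%E).
by by rewrite mule1 muleA -EFinM -expRD subrr expR0 mul1e => <-.
Qed.

Lemma x_sinh_ge0 b x : 0 <= b -> 0 <= x * sinh (b * x).
Proof.
move=> b0; wlog x0 : x / 0 <= x => [hw|].
  have [/hw//|x0] := leP 0 x.
  by have := hw (- x); rewrite mulrN sinhN mulrNN; apply; rewrite oppr_ge0 ltW.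
by rewrite mulr_ge0// sinh_ge0// mulr_ge0.
Qed.

Lemma measurable_xsinh b : measurable_fun [set: R] (fun x => x * sinh (b * x)).
Proof.
apply: measurable_funM => //; apply: measurableT_comp.
  exact: measurable_sinh.
exact: measurable_scale.
Qed.

(** Up to symmetrization, x sinh(b x) is x e^(b x), which the shift by b turns
    into the mean b of N(b, 1).  Since x is not nonnegative, the computation is
    made with x + e^(-x) >= 1 and the extra exponential is removed at the end,
    so that only integrals of nonnegative functions occur. *)
Lemma normal_xsinh b : 0 <= b ->
  (\int[gamma]_x (x * sinh (b * x))%:E = (b * expR (b ^+ 2 / 2))%:E)%E.
Proof.
move=> b0; pose g x : R := x + expR (- x).
have g0 x : 0 <= g x by rewrite /g; have := expR_ge1Dx (- x); lra.
have mg : measurable_fun [set: R] g.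
  by apply: measurable_funD => //; apply: measurableT_comp => //;
    exact: measurableT_comp.
have mexpN : measurable_fun [set: R] (fun x => (expR (- x))%:E).
  by apply/measurable_EFinP; apply: measurableT_comp => //; exact: measurableT_comp.
have intcosh : (\int[gamma]_x (cosh x)%:E = (expR (1 / 2))%:E)%E.
  have := normal_cosh 1; rewrite expr1n => <-.
  by apply: eq_integral => x _; rewrite mul1r.
have intg : (\int[gamma]_x (g x)%:E = (expR (1 / 2))%:E)%E.
  rewrite normal_symmetrize// -intcosh.
  by apply: eq_integral => x _; rewrite /g /cosh opprK; congr EFin; field.
have intexpN : (\int[gamma]_x (expR (- x))%:E = (expR (1 / 2))%:E)%E.
  rewrite (@normal_symmetrize _ (fun x => expR (- x)))//;
    last exact/measurable_EFinP.
  rewrite -intcosh.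
  by apply: eq_integral => x _; rewrite /cosh opprK addrC.
have mgb : measurable_fun [set: R] (fun x => (g (x + b))%:E).
  by apply/measurable_EFinP; apply: measurableT_comp => //; exact: measurable_funD.
have expNb : expR (- b) <= 1 by rewrite -expR0 ler_expR oppr_le0.
have shiftg : (\int[gamma]_x (g (x + b))%:E = (b + expR (1 / 2 - b))%:E)%E.
  have : (\int[gamma]_x (g (x + b))%:E + ((1 - expR (- b)) * expR (1 / 2))%:E =
      (expR (1 / 2) + b)%:E)%E.
    have mE : measurable_fun [set: R] (fun x : R => expR (- x)).
      exact/measurable_EFinP.
    have mG : measurable_fun [set: R] (fun x : R => g (x + b)).
      exact/measurable_EFinP.
    have k0 : 0 <= 1 - expR (- b) by rewrite subr_ge0.
    rewrite EFinM -intexpN -integralZ_ge0R//.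
    rewrite -integralD_ge0R//; last 2 first.
    - exact: measurable_funM.
    - by move=> x; rewrite mulr_ge0 ?expR_ge0.
    rewrite [RHS]EFinD -intg -(normal_cst b) -integralD_ge0R//.
    apply: eq_integral => x _; congr EFin.
    by rewrite /g opprD expRD; ring.
  set I := integral _ _ _; have : (0 <= I)%E.
    by apply: integral_ge0 => x _; rewrite lee_fin.
  case: I => [y _|//|//]; rewrite -EFinD => -[yE]; congr EFin.
  by rewrite expRD; lra.
have := normal_shift_sym b mg g0; rewrite shiftg.
pose k := expR (- (b ^+ 2 / 2)).
have -> : (\int[gamma]_x
    (k * ((g x * expR (b * x) + g (- x) * expR (- (b * x))) / 2))%:E =
    k%:E * (\int[gamma]_x (x * sinh (b * x))%:E +
            \int[gamma]_x (cosh ((b - 1) * x))%:E))%E.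
  have mc : measurable_fun [set: R] (fun x => cosh ((b - 1) * x)).
    apply: measurableT_comp; first exact: measurable_cosh.
    exact: measurable_scale.
  have mxs := measurable_xsinh b.
  have xs0 x : 0 <= x * sinh (b * x) by exact: x_sinh_ge0.
  have c0 x : 0 <= cosh ((b - 1) * x) by exact/ltW/cosh_gt0.
  rewrite -integralD_ge0R// -integralZ_ge0R//; last 3 first.
  - exact: expR_ge0.
  - exact: measurable_funD.
  - by move=> x; rewrite addr_ge0.
  apply: eq_integral => x _; congr (k * _)%:E.
  rewrite /g opprK /sinh /cosh.
  have -> : expR ((b - 1) * x) = expR (- x) * expR (b * x).
    by rewrite -expRD; congr expR; ring.
  have -> : expR (- ((b - 1) * x)) = expR x * expR (- (b * x)).
    by rewrite -expRD; congr expR; ring.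
  by field.
rewrite normal_cosh; set I := integral _ _ _; have : (0 <= I)%E.
  by apply: integral_ge0 => x _; rewrite lee_fin x_sinh_ge0.
have kK : k * expR (b ^+ 2 / 2) = 1 by rewrite -expRD addrC subrr expR0.
case: I => [y _|_|//].
  rewrite -EFinD -EFinM => -[yE]; congr EFin.
  have kE : k * expR ((b - 1) ^+ 2 / 2) = expR (1 / 2 - b).
    by rewrite -expRD; congr expR; field.
  move: yE; rewrite mulrDr kE => /addIr bE.
  by rewrite {1}bE mulrAC kK mul1r.
by rewrite addye// gt0_muley// lte_fin expR_gt0.
Qed.

(** The mean of log cosh (a X) for X of law N(a, 1).  Since the mixture of
    N(a, 1) and N(-a, 1) has density e^(-a^2/2) cosh(a x) with respect to
    N(0, 1), its divergence from N(0, 1) is [lncosh_mean a - a ^+ 2 / 2]. *)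
Definition lncosh_mean a : \bar R := (\int[gamma]_x (lncosh (a * (x + a)))%:E)%E.

Lemma measurable_lncosh_mean a :
  measurable_fun [set: R] (fun x => lncosh (a * (x + a))).
Proof.
apply: measurableT_comp; first exact: measurable_lncosh.
by apply: measurable_funM => //; exact: measurable_funD.
Qed.

Lemma lncosh_mean_ge0 a : (0 <= lncosh_mean a)%E.
Proof. by apply: integral_ge0R => x; exact: lncosh_ge0. Qed.

Lemma lncosh_meanN a : lncosh_mean (- a) = lncosh_mean a.
Proof.
rewrite /lncosh_mean -[RHS](@normal_reflection _
  (fun x => (lncosh (a * (x + a)))%:E)).
- by apply: eq_integral => x _; congr (lncosh _)%:E; ring.
- by apply/measurable_EFinP; exact: measurable_lncosh_mean.
- by move=> x; rewrite lee_fin lncosh_ge0.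
Qed.

(** The factor cosh(b x) of the symmetrized N(b, 1) density cancels the
    denominator of tanh. *)
Lemma normal_x_tanh b : 0 <= b ->
  (\int[gamma]_x ((x + b) * tanh (b * (x + b)))%:E = b%:E)%E.
Proof.
move=> b0; have mt : measurable_fun [set: R] (fun x => x * tanh (b * x)).
  apply: measurable_funM => //; apply: measurableT_comp.
    exact: measurable_tanh.
  exact: measurable_scale.
have t0 x : 0 <= x * tanh (b * x).
  move: b0; rewrite le_eqVlt => /predU1P[<-|b0].
    by rewrite mul0r /tanh sinh0 mul0r mulr0.
  by rewrite -(pmulr_rge0 _ b0) mulrA x_tanh_ge0.
rewrite (normal_shift_sym b mt t0).
transitivity (\int[gamma]_x (expR (- (b ^+ 2 / 2)) * (x * sinh (b * x)))%:E)%E.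
  apply: eq_integral => x _; congr (_ * _)%:E.
  by rewrite mulrN tanhN mulrNN -(tanh_cosh (b * x)) /cosh; field.
rewrite integralZ_ge0R ?expR_ge0//; last 2 first.
- exact: measurable_xsinh.
- by move=> x; exact: x_sinh_ge0.
rewrite normal_xsinh// -EFinM; congr EFin.
by rewrite mulrCA -expRD addNr expR0 mulr1.
Qed.

(** After symmetrization tanh(b x) becomes tanh(b x) sinh(b x), at most
    b x sinh(b x).  The constant 1 only makes the integrand nonnegative. *)
Lemma normal_1Dtanh b : 0 <= b ->
  (\int[gamma]_x (1 + tanh (b * (x + b)))%:E <= (1 + b ^+ 2)%:E)%E.
Proof.
move=> b0; have mt : measurable_fun [set: R] (fun x => 1 + tanh (b * x)).
  apply: measurable_funD => //; apply: measurableT_comp.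
    exact: measurable_tanh.
  exact: measurable_scale.
have mtN : measurable_fun [set: R] (fun x => 1 + tanh (b * - x)).
  exact: (measurableT_comp mt).
have meN : measurable_fun [set: R] (fun x => expR (- (b * x))).
  by under eq_fun do rewrite -mulNr; exact: measurable_expRZ.
have t0 x : 0 <= 1 + tanh (b * x) by have := tanh_geN1 (b * x); lra.
rewrite (normal_shift_sym b mt t0).
set k := expR (- (b ^+ 2 / 2)).
have mc : measurable_fun [set: R] (fun x => cosh (b * x)).
  apply: measurableT_comp; first exact: measurable_cosh.
  exact: measurable_scale.
have mxs := measurable_xsinh b.
have xs0 x : 0 <= x * sinh (b * x) by exact: x_sinh_ge0.
have c0 x : 0 <= cosh (b * x) by exact/ltW/cosh_gt0.
have k0 : 0 <= k by exact: expR_ge0.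
have mbxs : measurable_fun [set: R] (fun x => b * (x * sinh (b * x))).
  exact: measurable_funM.
have bxs0 x : 0 <= b * (x * sinh (b * x)) by rewrite mulr_ge0.
apply: (@le_trans _ _ (\int[gamma]_x
    (k * (cosh (b * x) + b * (x * sinh (b * x))))%:E)%E).
  apply: le_integral_ge0R.
  - apply: measurable_funM => //; apply: measurable_funM => //.
    by apply: measurable_funD; apply: measurable_funM => //;
      exact: measurable_expRZ.
  - by apply: measurable_funM => //; exact: measurable_funD.
  - by move=> x; rewrite mulr_ge0// divr_ge0// addr_ge0// mulr_ge0 ?expR_ge0.
  - move=> x; rewrite ler_wpM2l// mulrN tanhN.
    have := tanh_sinh_le (b * x); rewrite -mulrA.
    rewrite [X in X <= _ -> _](_ : _ =
      tanh (b * x) * (expR (b * x) - expR (- (b * x))) / 2); last first.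
      by rewrite /sinh; field.
    by rewrite /cosh; lra.
rewrite integralZ_ge0R//; last 2 first.
- exact: measurable_funD.
- by move=> x; rewrite addr_ge0.
rewrite integralD_ge0R// integralZ_ge0R// normal_cosh normal_xsinh//.
set e := expR (b ^+ 2 / 2).
have ke : k * e = 1 by rewrite -expRD addNr expR0.
have -> : (k%:E * (e%:E + b%:E * (b * e)%:E) = (k * (e + b * (b * e)))%:E)%E by [].
rewrite lee_fin (_ : k * _ = k * e * (1 + b ^+ 2)); first by rewrite ke mul1r.
by ring.
Qed.

(** A discrete derivative.  With X = b + xi, the tangent of log cosh at b X
    bounds the increment by (b - a) (X + a) tanh (b X), whose mean is at most
    (b - a) (b + a b^2). *)
Lemma lncosh_mean_step a b : 0 <= a -> a <= b ->
  (lncosh_mean b <= lncosh_mean a + ((b - a) * (b + a * b ^+ 2))%:E)%E.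
Proof.
move=> a0 ab; have b0 : 0 <= b by exact: le_trans ab.
have ba0 : 0 <= b - a by rewrite subr_ge0.
have mX : measurable_fun [set: R] (fun x => b * (x + b)).
  by apply: measurable_funM => //; exact: measurable_funD.
have mt : measurable_fun [set: R] (fun x => tanh (b * (x + b))).
  by apply: measurableT_comp mX; exact: measurable_tanh.
have mXt : measurable_fun [set: R] (fun x => (x + b) * tanh (b * (x + b))).
  by apply: measurable_funM => //; exact: measurable_funD.
have Xt0 x : 0 <= (x + b) * tanh (b * (x + b)).
  move: b0; rewrite le_eqVlt => /predU1P[<-|b_gt0].
    by rewrite mul0r /tanh sinh0 mul0r mulr0.
  by rewrite -(pmulr_rge0 _ b_gt0) mulrA x_tanh_ge0.
have mt1 : measurable_fun [set: R] (fun x => 1 + tanh (b * (x + b))).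
  exact: measurable_funD.
have t10 x : 0 <= 1 + tanh (b * (x + b)).
  by have := tanh_geN1 (b * (x + b)); lra.
have mat1 : measurable_fun [set: R] (fun x => a * (1 + tanh (b * (x + b)))).
  exact: measurable_funM.
have at10 x : 0 <= a * (1 + tanh (b * (x + b))) by rewrite mulr_ge0.
have mla := measurable_lncosh_mean a; have mlb := measurable_lncosh_mean b.
have la0 x : 0 <= lncosh (a * (x + a)) by exact: lncosh_ge0.
have lb0 x : 0 <= lncosh (b * (x + b)) by exact: lncosh_ge0.
(* Adding c makes the tangent bound an inequality of nonnegative functions. *)
pose c := (b - a) * a; have c0 : 0 <= c by rewrite mulr_ge0.
have : (lncosh_mean b + c%:E <= lncosh_mean a +
    (b - a)%:E * (b%:E + a%:E * (1 + b ^+ 2)%:E))%E.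
  apply: (@le_trans _ _ (lncosh_mean a + (b - a)%:E * (b%:E + a%:E *
    \int[gamma]_x (1 + tanh (b * (x + b)))%:E))%E); last first.
    rewrite leeD2l// lee_wpmul2l ?lee_fin// leeD2l// lee_wpmul2l ?lee_fin//.
    exact: normal_1Dtanh.
  rewrite -(normal_x_tanh b0) -integralZ_ge0R// -integralD_ge0R//.
  rewrite -integralZ_ge0R//; last 2 first.
  - exact: measurable_funD.
  - by move=> x; rewrite addr_ge0.
  rewrite -[X in (lncosh_mean b + X)%E]normal_cst /lncosh_mean.
  rewrite -integralD_ge0R// -integralD_ge0R//; last 2 first.
  - by apply: measurable_funM => //; exact: measurable_funD.
  - by move=> x; rewrite mulr_ge0// addr_ge0.
  apply: le_integral_ge0R.
  - exact: measurable_funD.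
  - apply: measurable_funD => //; apply: measurable_funM => //.
    exact: measurable_funD.
  - by move=> x; rewrite addr_ge0.
  - move=> x; have := lncosh_tangent (a * (x + a)) (b * (x + b)).
    set u := lncosh _; set v := lncosh _; set t := tanh _ => uv.
    rewrite -subr_ge0 /c; move: uv; rewrite -subr_ge0.
    by congr (0 <= _); ring.
move: (lncosh_mean_ge0 b) (lncosh_mean_ge0 a).
case: (lncosh_mean b) => [y| |]; case: (lncosh_mean a) => [z| |]//= _ _.
- change (((y + c)%:E <= (z + (b - a) * (b + a * (1 + b ^+ 2)))%:E)%E ->
    (y%:E <= (z + (b - a) * (b + a * b ^+ 2))%:E)%E).
  rewrite !lee_fin /c => h; rewrite -subr_ge0; move: h; rewrite -subr_ge0.
  by congr (0 <= _); ring.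
- by move=> _; rewrite (@addye _ (_)%:E)// leey.
Qed.

(** Summing the steps over a regular subdivision of [0, a] bounds the mean by a
    Riemann sum of b + b^3, whose integral over [0, a] is a^2/2 + a^4/4. *)
Lemma lncosh_mean_le a : (lncosh_mean a <= (a ^+ 2 / 2 + a ^+ 4 / 4)%:E)%E.
Proof.
wlog a0 : a / 0 <= a => [hw|].
  have [/hw//|a0] := leP 0 a.
  have := hw (- a); rewrite lncosh_meanN !sqrrN (_ : (- a) ^+ 4 = a ^+ 4).
    by apply; rewrite oppr_ge0 ltW.
  by ring.
(* The two sums are sum_i i = n(n+1)/2 and sum_i i^3 = (n(n+1)/2)^2. *)
have telescope (h : R) (n : nat) : 0 <= h -> (lncosh_mean (n%:R * h) <=
    (h ^+ 2 * (n%:R * (n%:R + 1)) / 2 +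
     h ^+ 4 * (n%:R * (n%:R + 1)) ^+ 2 / 4)%:E)%E.
  move=> h0; elim: n => [|n ih].
    rewrite !mul0r /lncosh_mean; under eq_integral do rewrite mul0r.
    rewrite normal_cst lee_fin /lncosh /cosh oppr0 expR0 divff//.
    by rewrite ln1; lra.
  have hn : n%:R * h <= n.+1%:R * h by rewrite ler_wpM2r// ler_nat.
  have hn0 : 0 <= n%:R * h by rewrite mulr_ge0.
  apply: (le_trans (lncosh_mean_step hn0 hn)).
  apply: (le_trans (leeD2r _ ih)); rewrite -EFinD lee_fin -natr1.
  have n0 : 0 <= n%:R :> R by [].
  set N := n%:R in n0 *; rewrite -subr_ge0.
  rewrite (_ : _ - _ = h ^+ 4 * (N + 1) ^+ 2); last by field.
  by rewrite mulr_ge0 ?exprn_ge0// addr_ge0.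
apply/lee_addgt0Pr => e e0.
pose C := a ^+ 2 / 2 + a ^+ 4.
have C0 : 0 <= C by rewrite addr_ge0 ?divr_ge0 ?exprn_ge0.
have [n nC] : exists n : nat, C / e <= n.+1%:R.
  exists (Num.truncn (C / e)); exact/ltW/truncnS_gt.
have := telescope (a / n.+1%:R) n.+1 (divr_ge0 a0 (ler0n _ _)).
rewrite mulrCA divff ?mulr1 ?pnatr_eq0// => /le_trans; apply.
rewrite -EFinD lee_fin; set N : R := n.+1%:R in nC *.
have N1 : 1 <= N by rewrite ler1n.
have N0 : 0 < N by exact: lt_le_trans N1.
have -> : (a / N) ^+ 2 * (N * (N + 1)) / 2 +
    (a / N) ^+ 4 * (N * (N + 1)) ^+ 2 / 4 =
    a ^+ 2 / 2 * (1 + N^-1) + a ^+ 4 / 4 * (1 + N^-1) ^+ 2.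
  by field; rewrite gt_eqF.
have CeN : C * N^-1 <= e by rewrite ler_pdivrMr// mulrC -ler_pdivrMr.
have V1 : N^-1 <= 1 by rewrite invf_le1.
have V0 : 0 <= N^-1 by rewrite invr_ge0 ltW.
move: (N^-1) V0 V1 CeN => V V0 V1 CeN.
have sq : (1 + V) ^+ 2 <= 1 + 4 * V by nra.
have a4 : 0 <= a ^+ 4 / 4 by rewrite divr_ge0 ?exprn_ge0.
have := ler_wpM2l a4 sq; rewrite /C in CeN; lra.
Qed.
End lncosh_mean.

(** * Gaussian sequences and the Cameron-Martin formula *)

Section gaussian_sequence.
Context {R : realType} {d : nat}.
Local Notation gamma := (normal_prob (0 : R) 1).
Local Notation obs := (@obs_space R d).
Local Notation index := ('I_d * int)%type.
Implicit Types (i : index) (J : {fset index}) (B : index -> set R) (x : obs).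

Lemma measurable_coord (j : 'I_d) (k : int) :
  measurable_fun [set: obs] (fun x : obs => x j k).
Proof.
move=> _ B mB; rewrite setTI; apply: sub_sigma_algebra.
by exists j, k, B.
Qed.

Lemma measurable_obs disp (T : measurableType disp) (f : T -> obs) :
  (forall j k, measurable_fun [set: T] (fun t => f t j k)) ->
  measurable_fun [set: T] f.
Proof.
move=> mf; apply: (@measurability _ _ T obs setT f (@cylinders R d)) => //.
move=> _ [_ [j [k [B [mB ->]]]] <-].
exact: (mf j k measurableT B mB).
Qed.

Definition box J B : set obs := [set x | forall i, i \in J -> B i (x i.1 i.2)].

Lemma measurable_box J B : (forall i, measurable (B i)) -> measurable (box J B).
Proof.
move=> mB; have -> : box J B =
    \bigcap_(i in [set` J]) ((fun x : obs => x i.1 i.2) @^-1` B i).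
  by apply/seteqP; split => x.
apply: fin_bigcap_measurable => // i _.
by rewrite -[X in measurable X]setTI; exact: measurable_coord.
Qed.

(** Boxes form a pi-system generating the product sigma-algebra. *)
Lemma box_measure_unique (m1 m2 : {measure set obs -> \bar R}) :
  (m1 [set: obs] < +oo)%E ->
  (forall J B, (forall i, measurable (B i)) -> m1 (box J B) = m2 (box J B)) ->
  forall A, measurable A -> m1 A = m2 A.
Proof.
move=> m1oo m12.
pose G : set (set obs) :=
  [set A | exists J B, (forall i, measurable (B i)) /\ A = box J B].
apply: (measure_unique G (fun=> [set: obs])) => //.
- apply/seteqP; split.
    apply: smallest_sub; first exact: smallest_sigma_algebra.
    move=> _ [j [k [B [mB ->]]]]; apply: sub_sigma_algebra.
    exists [fset (j, k)]%fset, (fun=> B); split => //.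
    apply/seteqP; split => [x Bx i|x /(_ (j, k))].
      by rewrite inE => /eqP ->.
    by apply; rewrite inE.
  apply: smallest_sub; first exact: sigma_algebra_measurable.
  by move=> _ [J [B [mB ->]]]; exact: measurable_box.
- move=> _ _ [J [B [mB ->]]] [J' [B' [mB' ->]]].
  exists (J `|` J')%fset, (fun i => (if i \in J then B i else setT) `&`
    (if i \in J' then B' i else setT)); split.
    by move=> i; apply: measurableI; case: ifP.
  apply/seteqP; split => x.
    by move=> [xB xB'] i _; split; case: ifPn => // iJ; [exact: xB|exact: xB'].
  move=> xB; split => i iJ; have := xB i; rewrite inE iJ ?orbT => /(_ isT)[] //.
- move=> _; exists fset0, (fun=> setT); split => //.
  by apply/seteqP; split => x.
- by rewrite bigcup_const//; exists 0%N.
- by move=> _ [J [B [mB ->]]]; exact: m12.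
Qed.

Definition iid_gaussian (mu : set obs -> \bar R) := forall J B,
  (forall i, measurable (B i)) -> mu (box J B) = (\prod_(i <- J) gamma (B i))%E.

Variable mu : {measure set obs -> \bar R}.
Hypothesis mu_iid : iid_gaussian mu.

Lemma iid_gaussian_setT : mu [set: obs] = 1%E.
Proof.
have -> : [set: obs] = box fset0 (fun=> setT) by apply/seteqP; split.
by rewrite mu_iid// big_seq_fset0.
Qed.

(** Independence is assumed for events; both sides are integrals of g for two
    measures on R that agree on sets. *)
Lemma iid_gaussian_indep i J B (g : R -> \bar R) :
  i \notin J -> (forall i, measurable (B i)) ->
  measurable_fun [set: R] g -> (forall y, 0 <= g y)%E ->
  (\int[mu]_x (g (x i.1 i.2) * (\1_(box J B) x)%:E) =
   mu (box J B) * \int[gamma]_y g y)%E.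
Proof.
move=> iJ mB mg g0; set C := box J B.
have mC : measurable C by exact: measurable_box.
have mi : measurable_fun [set: obs] (fun x : obs => x i.1 i.2).
  exact: measurable_coord.
rewrite -(@ge0_integral_density _ _ _ mu _ _ _ (mrestr mu mC)
  (fun x => g (x i.1 i.2)))//; last 2 first.
- by move=> A mA; rewrite integral_indic// /mrestr setIC.
- exact: measurableT_comp.
have := ge0_integral_pushforward
  (mi : measurable_fun [set: obs] (_ : obs -> measurableTypeR R))
  (mrestr mu mC) measurableT mg.
rewrite preimage_setT => <- //.
have C0 : (0 <= fine (mu C))%R by rewrite fine_ge0.
have Cfin : mu C \is a fin_num.
  rewrite ge0_fin_numE// (@le_lt_trans _ _ 1%E) ?ltry//.
  by rewrite -iid_gaussian_setT le_measure// inE.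
rewrite -[X in (X * _)%E](fineK Cfin).
rewrite -(@ge0_integral_mscale _ _ _ _ _ _ (NngNum C0))//.
apply: eq_measure_integral => A mA _.
rewrite -[RHS]/((fine (mu C))%:E * gamma A)%E (fineK Cfin).
rewrite -[LHS]/(mu ((fun x : obs => x i.1 i.2) @^-1` A `&` C)).
(* Fixing the coordinate i in A as well gives a box over i |` J. *)
pose B' i' := if i' == i then A else B i'.
have mB' i' : measurable (B' i').
  by rewrite /B'; case: ifP => _; [exact: mA|exact: mB].
have -> : (fun x : obs => x i.1 i.2) @^-1` A `&` C = box (i |` J)%fset B'.
  apply/seteqP; split => x.
    move=> [xA xC] i'; rewrite /B' !inE => /orP[/eqP ->|i'J].
      by rewrite eqxx.
    by case: eqP => [->//|_]; exact: xC.
  move=> xB; split.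
    by have := xB i; rewrite /B' eqxx; apply; rewrite !inE eqxx.
  move=> i' i'J; have := xB i'; rewrite /B'.
  case: eqP i'J => [->|_] i'J; first by rewrite (negbTE iJ) in i'J.
  by apply; rewrite !inE i'J orbT.
rewrite !mu_iid// big_fsetU1//= {1}/B' eqxx muleC; congr (_ * _)%E.
apply: eq_big_seq => i' i'J; rewrite /B'; case: eqP => // e.
by rewrite -e i'J in iJ.
Qed.

Definition shift1 i (a : R) (x : obs) : obs :=
  fun j k => x j k + (if (j, k) == i then a else 0).

Lemma measurable_shift1 i a : measurable_fun [set: obs] (shift1 i a).
Proof.
apply: measurable_obs => j k; apply: measurable_funD => //.
exact: measurable_coord.
Qed.

(** The law of the shifted sequence and the law with the exponential density
    agree on boxes: independence separates the shifted coordinate from the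
    others, and for that coordinate this is [normal_shift]. *)
Lemma cameron_martin1 i (a : R) (f : obs -> \bar R) :
  measurable_fun [set: obs] f -> (forall x, 0 <= f x)%E ->
  (\int[mu]_x f (shift1 i a x) =
   \int[mu]_x (f x * (expR (a * x i.1 i.2 - a ^+ 2 / 2))%:E))%E.
Proof.
move=> mf f0; have mi : measurable_fun [set: obs] (fun x : obs => x i.1 i.2).
  exact: measurable_coord.
pose e y : R := expR (a * y - a ^+ 2 / 2).
have me : measurable_fun [set: R] e.
  by apply: measurableT_comp => //; exact: measurable_affine.
pose h (x : obs) := e (x i.1 i.2).
have mh : measurable_fun [set: obs] h by exact: (measurableT_comp me).
have h0 x : 0 <= h x by exact: expR_ge0.
have ms := measurable_shift1 i a.
have := ge0_integral_pushforward ms mu measurableT mf.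
rewrite preimage_setT => <- //.
apply: (@ge0_integral_density _ _ _ mu h) => //.
move=> A mA; rewrite -[RHS]/(density mu h0 mh A).
apply: box_measure_unique mA => /=.
  by rewrite /pushforward preimage_setT iid_gaussian_setT ltry.
move=> {A} J B mB; rewrite /pushforward /density.
pose J' := (J `\ i)%fset; pose Bi := if i \in J then B i else setT.
have mBi : measurable Bi by rewrite /Bi; case: ifP.
have iJ' : i \notin J' by rewrite !inE eqxx.
have mC := measurable_box J' mB.
have boxE : box J B = (fun x : obs => x i.1 i.2) @^-1` Bi `&` box J' B.
  apply/seteqP; split => x.
    move=> xB; split.
      by rewrite /Bi /=; case: ifPn => // iJ; exact: xB.
    by move=> i'; rewrite !inE => /andP[_ i'J]; exact: xB.
  move=> [xBi xB] i' i'J; have [e'|i'i] := eqVneq i' i.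
    by move: xBi; rewrite /Bi -e' i'J.
  by apply: xB; rewrite !inE i'i.
have shiftE : shift1 i a @^-1` box J B =
    (fun x : obs => x i.1 i.2) @^-1` ((fun y => y + a) @^-1` Bi) `&` box J' B.
  rewrite boxE; apply/seteqP; split => x; rewrite /shift1/=.
    rewrite -surjective_pairing eqxx => -[xi xB]; split => // i' i'J.
    have := xB _ i'J; rewrite -surjective_pairing; case: eqP => [e'|_].
      by rewrite e' (negbTE iJ') in i'J.
    by rewrite addr0.
  rewrite -surjective_pairing eqxx => -[xi xB]; split => // i' i'J.
  rewrite /= -surjective_pairing; case: eqP => [e'|_].
    by rewrite e' (negbTE iJ') in i'J.
  by rewrite addr0; exact: xB.
have mBia : measurable ((fun y : R => y + a) @^-1` Bi).
  by rewrite -[X in measurable X]setTI; exact: measurable_funD.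
transitivity (\int[mu]_x ((\1_Bi (x i.1 i.2 + a))%:E * (\1_(box J' B) x)%:E))%E.
  rewrite shiftE -[in LHS](setIT (_ `&` _)) -integral_indic//.
    by apply: eq_integral => x _; rewrite indicI -EFinM.
  by apply: measurableI => //; rewrite -[X in measurable X]setTI; exact: mi.
have mind : measurable_fun [set: R] (fun y : R => (\1_Bi y)%:E : \bar R).
  by apply/measurable_EFinP; exact: measurable_indic.
have minda : measurable_fun [set: R] (fun y : R => (\1_Bi (y + a))%:E : \bar R).
  by apply: (measurableT_comp mind); exact: measurable_funD.
rewrite (iid_gaussian_indep (g := fun y => (\1_Bi (y + a))%:E) iJ')//.
rewrite (@normal_shift _ (fun y => (\1_Bi y)%:E))//.
rewrite -(iid_gaussian_indep iJ' mB)//; last first.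
  by apply: emeasurable_funM => //; exact/measurable_EFinP.
rewrite [RHS]integral_mkcond; apply: eq_integral => x _.
by rewrite epatch_indic boxE indicI /= EFinM -muleA muleCA.
Qed.

End gaussian_sequence.

(** * Random signs and Fano's inequality *)

Section random_signs.
Context {R : realType} {d : nat}.
Local Notation gamma := (normal_prob (0 : R) 1).
Local Notation obs := (@obs_space R d).
Implicit Types (x : obs) (j : 'I_d) (g : int -> R).

Definition shift_row j g (x : obs) : obs :=
  fun j' k => x j' k + (if j' == j then g k else 0).

Lemma measurable_shift_row j g : measurable_fun [set: obs] (shift_row j g).
Proof.
apply: measurable_obs => j' k; apply: measurable_funD => //.
exact: measurable_coord.
Qed.

Variable mu : {measure set obs -> \bar R}.
Hypothesis mu_iid : iid_gaussian mu.

Lemma iid_gaussian_marginal j (k : int) (f : R -> \bar R) :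
  measurable_fun [set: R] f -> (forall y, 0 <= f y)%E ->
  (\int[mu]_x f (x j k) = \int[gamma]_y f y)%E.
Proof.
move=> mf f0.
have := @iid_gaussian_indep _ _ _ mu_iid (j, k) fset0 (fun=> setT) f.
have -> : box fset0 (fun=> setT) = [set: obs] by apply/seteqP; split.
rewrite (iid_gaussian_setT mu_iid) mul1e => <- //.
by apply: eq_integral => x _; rewrite indicT mule1.
Qed.

(** One coordinate at a time: a shift of coordinate k leaves the weights of the
    other coordinates unchanged. *)
Lemma cameron_martin_row j (K : seq int) g (f : obs -> R) :
  uniq K -> (forall k, k \notin K -> g k = 0) ->
  measurable_fun [set: obs] f -> (forall x, 0 <= f x) ->
  (\int[mu]_x (f (shift_row j g x))%:E = \int[mu]_x
    (f x * \prod_(k <- K) expR (g k * x j k - g k ^+ 2 / 2))%:E)%E.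
Proof.
elim: K g f => [|k K IH] g f /=.
  move=> _ g0 mf f0; apply: eq_integral => x _; rewrite big_nil mulr1.
  congr (f _)%:E; apply/funext => j'; apply/funext => k; rewrite /shift_row.
  by rewrite g0// if_same addr0.
move=> /andP[kK uK] g0 mf f0.
pose g' k' := if k' == k then 0 else g k'.
have g'E k' : k' \in K -> g' k' = g k'.
  by move=> k'K; rewrite /g'; case: eqP => // e; rewrite -e k'K in kK.
have g'0 k' : k' \notin K -> g' k' = 0.
  rewrite /g'; case: eqP => // /eqP k'k k'K; apply: g0.
  by rewrite inE negb_or k'k.
have shiftE x : shift_row j g x = shift1 (j, k) (g k) (shift_row j g' x).
  apply/funext => j'; apply/funext => k'; rewrite /shift_row /shift1 /g' xpair_eqE.
  by case: (j' == j); case: eqP => [->|_] /=; rewrite ?addr0.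
have ms := @measurable_shift1 R d (j, k) (g k).
have mfs : measurable_fun [set: obs] (fun x => f (shift1 (j, k) (g k) x)).
  exact: (measurableT_comp mf).
have mW : measurable_fun [set: obs] (fun x : obs =>
    \prod_(k0 <- K) expR (g k0 * x j k0 - g k0 ^+ 2 / 2)).
  apply: measurable_prod => k' _; apply: measurableT_comp => //.
  apply: measurable_funD => //; apply: measurable_funM => //.
  exact: measurable_coord.
pose F x := f x * \prod_(k0 <- K) expR (g k0 * x j k0 - g k0 ^+ 2 / 2).
have mF : measurable_fun [set: obs] F by exact: measurable_funM.
have F0 x : 0 <= F x by rewrite mulr_ge0// prodr_ge0// => i _; exact: expR_ge0.
under eq_integral do rewrite shiftE.
rewrite (IH g' (fun x => f (shift1 (j, k) (g k) x)))//.
transitivity (\int[mu]_x (F (shift1 (j, k) (g k) x))%:E)%E.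
  apply: eq_integral => x _; congr (_ * _)%:E; apply: eq_big_seq => k' k'K.
  rewrite g'E// /shift1 xpair_eqE eqxx /=; case: eqP => [e|_].
    by rewrite -e k'K in kK.
  by rewrite addr0.
rewrite (@cameron_martin1 _ _ mu mu_iid (j, k) (g k) (fun x => (F x)%:E))//.
- apply: eq_integral => x _; rewrite -EFinM; congr EFin.
  by rewrite big_cons /F /= -mulrA; congr (_ * _); rewrite mulrC.
- exact/measurable_EFinP.
Qed.

Variables (J : {fset int}) (a : int -> R).

Definition signed (w : {ffun J -> bool}) (k : int) : R :=
  if insub k is Some i then (-1) ^+ w i * a k else 0.

Definition likelihood_ratio j (x : obs) : R :=
  \prod_(k <- J) (expR (- (a k ^+ 2 / 2)) * cosh (a k * x j k)).

Lemma likelihood_ratio_gt0 j x : 0 < likelihood_ratio j x.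
Proof.
by apply: prodr_gt0 => k _; rewrite mulr_gt0 ?expR_gt0 ?cosh_gt0.
Qed.

Lemma measurable_likelihood_ratio j :
  measurable_fun [set: obs] (likelihood_ratio j).
Proof.
apply: measurable_prod => k _; apply: measurable_funM => //.
apply: measurableT_comp; first exact: measurable_cosh.
by apply: measurable_funM => //; exact: measurable_coord.
Qed.

(** The average over all signs of a product over J is the product of the
    averages, and averaging exp(+-a x - a^2/2) gives e^(-a^2/2) cosh(a x). *)
Lemma random_signs_density j (f : obs -> R) :
  measurable_fun [set: obs] f -> (forall x, 0 <= f x) ->
  (\sum_(w : {ffun J -> bool}) \int[mu]_x (f (shift_row j (signed w) x))%:E =
   (2 ^+ #|{: J}|)%:E * \int[mu]_x (f x * likelihood_ratio j x)%:E)%E.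
Proof.
move=> mf f0.
pose W (w : {ffun J -> bool}) (x : obs) : R :=
  \prod_(k <- J) expR (signed w k * x j k - signed w k ^+ 2 / 2).
have mW w : measurable_fun [set: obs] (W w).
  apply: measurable_prod => k' _; apply: measurableT_comp => //.
  apply: measurable_funD => //; apply: measurable_funM => //.
  exact: measurable_coord.
have W0 w x : 0 <= W w x by apply: prodr_ge0 => k _; exact: expR_ge0.
transitivity (\sum_(w : {ffun J -> bool}) \int[mu]_x (f x * W w x)%:E)%E.
  apply: eq_bigr => w _; apply: cameron_martin_row => //.
    exact: fset_uniq.
  by move=> k kJ; rewrite /signed insubF//; exact: negbTE.
rewrite -integral_sum_ge0R//; last 2 first.
- by move=> w; exact: measurable_funM.
- by move=> w x; rewrite mulr_ge0.
have sumW x : \sum_w W w x = 2 ^+ #|{: J}| * likelihood_ratio j x.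
  transitivity (\sum_(w : {ffun J -> bool}) \prod_(k : J)
      expR ((-1) ^+ w k * a (val k) * x j (val k) -
            ((-1) ^+ w k * a (val k)) ^+ 2 / 2)).
    apply: eq_bigr => w _; rewrite /W big_seq_fsetE.
    by apply: eq_bigr => k _; rewrite /signed valK.
  rewrite -(bigA_distr_bigA (fun (k : J) (b : bool) =>
    expR ((-1) ^+ b * a (val k) * x j (val k) -
          ((-1) ^+ b * a (val k)) ^+ 2 / 2))) /=.
  rewrite /likelihood_ratio big_seq_fsetE /= -prodr_const -big_split /=.
  apply: eq_bigr => k _; rewrite big_bool /= expr0 expr1 !mulN1r !mul1r.
  by rewrite sqrrN mulNr !expRD /cosh; field.
have mL := measurable_likelihood_ratio j.
have L0 x : 0 <= likelihood_ratio j x by exact/ltW/likelihood_ratio_gt0.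
rewrite -integralZ_ge0R//; last 2 first.
- exact: measurable_funM.
- by move=> x; rewrite mulr_ge0.
by apply: eq_integral => x _; rewrite -mulr_sumr sumW mulrCA.
Qed.

Lemma iid_gaussian_cst (c : R) : (\int[mu]_x c%:E = c%:E)%E.
Proof.
by rewrite (integral_cst _ measurableT) (iid_gaussian_setT mu_iid) mule1.
Qed.

Lemma integral_likelihood_ratio j :
  (\int[mu]_x (likelihood_ratio j x)%:E = 1)%E.
Proof.
have := @random_signs_density j (cst 1) (measurable_cst _) (fun=> ler01).
rewrite (eq_bigr (fun=> 1%:E)); last by move=> w _; exact: (iid_gaussian_cst 1).
rewrite sumEFin sumr_const card_ffun card_bool natrX.
under eq_integral do rewrite mul1r.
have p0 : (0 : R) < 2 ^+ #|{: J}| by rewrite exprn_gt0.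
have : (0 <= \int[mu]_x (likelihood_ratio j x)%:E)%E.
  by apply: integral_ge0R => x; exact/ltW/likelihood_ratio_gt0.
case: (integral _ _ _) => [y _|_|//]; last by rewrite gt0_muley.
rewrite -EFinM => -[e]; congr EFin.
by apply: (mulfI (lt0r_neq0 p0)); rewrite mulr1 -e.
Qed.

(** Under the law with density [likelihood_ratio], coordinate k is a noise
    shifted by +-a_k, and log cosh is even. *)
Lemma integral_likelihood_ratio_lncosh j k : k \in J ->
  (\int[mu]_x (lncosh (a k * x j k) * likelihood_ratio j x)%:E =
   lncosh_mean (a k))%E.
Proof.
move=> kJ.
have ml : measurable_fun [set: R] (fun y => lncosh (a k * y)).
  by apply: measurableT_comp; [exact: measurable_lncosh|exact: measurable_scale].
have mf : measurable_fun [set: obs] (fun x : obs => lncosh (a k * x j k)).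
  by apply: (measurableT_comp ml); exact: measurable_coord.
have := @random_signs_density j _ mf (fun x => lncosh_ge0 _).
have signE (w : {ffun J -> bool}) :
    (\int[mu]_x (lncosh (a k * shift_row j (signed w) x j k))%:E =
     lncosh_mean (a k))%E.
  under eq_integral do rewrite /shift_row eqxx.
  rewrite (@iid_gaussian_marginal j k
    (fun y => (lncosh (a k * (y + signed w k)))%:E)).
  - rewrite /signed insubT /=; case: (w _); rewrite ?expr0 ?expr1.
      rewrite -(lncosh_meanN (a k)); apply: eq_integral => y _.
      by rewrite -(lncoshN (- a k * _)); congr (lncosh _)%:E; ring.
    by apply: eq_integral => y _; congr (lncosh _)%:E; ring.
  - apply/measurable_EFinP; apply: (measurableT_comp ml).
    exact: measurable_funD.
  - by move=> y; rewrite lee_fin lncosh_ge0.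
have [z zE] : exists z, lncosh_mean (a k) = z%:E.
  have : (0 <= lncosh_mean (a k) < +oo)%E.
    by rewrite lncosh_mean_ge0 (le_lt_trans (lncosh_mean_le _))// ltry.
  by case: (lncosh_mean _) => [z _|/andP[]//|/andP[]//]; exists z.
rewrite zE in signE *.
rewrite (eq_bigr (fun=> z%:E)); last by move=> w _; exact: signE.
rewrite sumEFin sumr_const card_ffun card_bool -[z *+ _]mulr_natl natrX.
have p0 : (0 : R) < 2 ^+ #|{: J}| by rewrite exprn_gt0.
have : (0 <= \int[mu]_x (lncosh (a k * x j k) * likelihood_ratio j x)%:E)%E.
  apply: integral_ge0R => x.
  by rewrite mulr_ge0 ?lncosh_ge0// ltW// likelihood_ratio_gt0.
case: (integral _ _ _) => [y _|_|//]; last by rewrite gt0_muley.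
by rewrite -EFinM => -[/esym e]; congr EFin; exact: (mulfI (lt0r_neq0 p0)).
Qed.

(** For a = v / eps this is half of sum_k v_k^4 / (2 eps^4), the quantity whose
    infimum over the class is u^2. *)
Definition kl_bound : R := \sum_(k <- J) a k ^+ 4 / 4.

Lemma kl_bound_ge0 : 0 <= kl_bound.
Proof. by apply: sumr_ge0 => k _; rewrite divr_ge0// exprn_even_ge0. Qed.

(** Integrates L y <= L log L - L + e^y for y = log m 1_E.  The negative part of
    log L is at most c = sum_k a_k^2/2, and adding c L to both sides leaves only
    nonnegative integrands. *)
Lemma likelihood_ratio_fano (m : nat) j (E : set obs) : (0 < m)%N -> measurable E ->
  ((ln m%:R)%:E * \int[mu]_x (\1_E x * likelihood_ratio j x)%:E <=
   kl_bound%:E + (m%:R - 1)%:E * mu E)%E.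
Proof.
move=> m0 mE; set L := likelihood_ratio j; set lam := ln _.
have mL : measurable_fun [set: obs] L by exact: measurable_likelihood_ratio.
have L0 x : 0 < L x by exact: likelihood_ratio_gt0.
have L0' x : 0 <= L x by exact: ltW.
have m1 : 1 <= m%:R :> R by rewrite ler1n.
have lam0 : 0 <= lam by rewrite ln_ge0.
pose S (x : obs) := \sum_(k <- J) lncosh (a k * x j k).
pose c := \sum_(k <- J) a k ^+ 2 / 2.
have c0 : 0 <= c by apply: sumr_ge0 => k _; rewrite divr_ge0// sqr_ge0.
have lnL x : ln (L x) = S x - c.
  rewrite /L /likelihood_ratio /S /c.
  elim: (enum_fset J) => [|k K IH]; first by rewrite !big_nil ln1 subr0.
  rewrite !big_cons lnM ?posrE ?IH; last 2 first.
  - by rewrite mulr_gt0 ?expR_gt0 ?cosh_gt0.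
  - by apply: prodr_gt0 => k' _; rewrite mulr_gt0 ?expR_gt0 ?cosh_gt0.
  by rewrite lnM ?posrE ?expR_gt0 ?cosh_gt0// expRK /lncosh; ring.
have S0 x : 0 <= S x by apply: sumr_ge0 => k _; exact: lncosh_ge0.
have ind01 x : \1_E x = 0 :> R \/ \1_E x = 1 :> R.
  by rewrite indicE; case: (_ \in _); [right|left].
have ind0 x : 0 <= \1_E x :> R by case: (ind01 x) => ->.
have pointwise x : lam * (\1_E x * L x) + (1 + c) * L x <=
    \sum_(k <- J) lncosh (a k * x j k) * L x + (1 + (m%:R - 1) * \1_E x).
  rewrite -mulr_suml -/(S x).
  have : expR (lam * \1_E x) = 1 + (m%:R - 1) * \1_E x.
    case: (ind01 x) => ->; rewrite ?mulr0 ?mulr1 ?expR0 ?addr0//.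
    by rewrite lnK ?posrE ?ltr0n// addrC subrK.
  move=> <-.
  have -> : expR (lam * \1_E x) = L x * expR (lam * \1_E x - ln (L x)).
    by rewrite expRD expRN lnK ?posrE// mulrCA divff ?mulr1// gt_eqF.
  have := expR_ge1Dx (lam * \1_E x - ln (L x)).
  rewrite -(ler_pM2l (L0 x)) lnL => h.
  rewrite -subr_ge0; move: h; rewrite -subr_ge0.
  by congr (0 <= _); ring.
have mS k : measurable_fun [set: obs] (fun x : obs => lncosh (a k * x j k) * L x).
  apply: measurable_funM => //; apply: measurableT_comp.
    exact: measurable_lncosh.
  by apply: measurable_funM => //; exact: measurable_coord.
have mI : measurable_fun [set: obs] (\1_E : obs -> R) by exact: measurable_indic.
have mIL : measurable_fun [set: obs] (fun x => \1_E x * L x).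
  exact: measurable_funM.
have IL0 x : 0 <= \1_E x * L x by rewrite mulr_ge0.
have mlIL : measurable_fun [set: obs] (fun x => lam * (\1_E x * L x)).
  exact: measurable_funM.
have mcL : measurable_fun [set: obs] (fun x => (1 + c) * L x).
  exact: measurable_funM.
have m10 : 0 <= m%:R - 1 :> R by rewrite subr_ge0.
have mmI : measurable_fun [set: obs] (fun x : obs => (m%:R - 1) * \1_E x : R).
  exact: measurable_funM.
have mm1 : measurable_fun [set: obs] (fun x : obs => 1 + (m%:R - 1) * \1_E x : R).
  exact: measurable_funD.
have mSL : measurable_fun [set: obs] (fun x : obs =>
    \sum_(k <- J) lncosh (a k * x j k) * L x).
  exact: measurable_sum.
have kS0 k x : 0 <= lncosh (a k * x j k) * L x by rewrite mulr_ge0 ?lncosh_ge0.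
have SL0 x : 0 <= \sum_(k <- J) lncosh (a k * x j k) * L x.
  by apply: sumr_ge0 => k _.
have mI0 x : 0 <= (m%:R - 1) * \1_E x :> R by rewrite mulr_ge0.
have c10 : 0 <= 1 + c by rewrite addr_ge0.
have lIL0 x : 0 <= lam * (\1_E x * L x) by rewrite mulr_ge0.
have cL0 x : 0 <= (1 + c) * L x by rewrite mulr_ge0// addr_ge0.
have := @le_integral_ge0R _ _ _ mu _ _ (measurable_funD mlIL mcL)
  (measurable_funD mSL mm1) (fun x => addr_ge0 (lIL0 x) (cL0 x)) pointwise.
rewrite integralD_ge0R// integralD_ge0R//.
rewrite integralD_ge0R// iid_gaussian_cst !integralZ_ge0R//.
rewrite integral_likelihood_ratio mule1 integral_sum_ge0R// integral_indic// setIT.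
have sum_le : (\sum_(k <- J) \int[mu]_x (lncosh (a k * x j k) * L x)%:E <=
    (c + kl_bound)%:E)%E.
  rewrite (eq_big_seq (fun k => lncosh_mean (a k))); last first.
    by move=> k kJ; exact: integral_likelihood_ratio_lncosh.
  rewrite /c /kl_bound -big_split -sumEFin.
  by apply: lee_sum => k _; exact: lncosh_mean_le.
have muE : mu E \is a fin_num.
  rewrite ge0_fin_numE// (@le_lt_trans _ _ 1%E) ?ltry//.
  by rewrite -(iid_gaussian_setT mu_iid) le_measure// inE.
rewrite -(fineK muE) => h.
have {}h := le_trans h (leeD2r _ sum_le).
rewrite -(@leeD2rE _ (1 + c)%:E)//; apply: (le_trans h).
set e := fine _.
change ((c + kl_bound + (1 + (m%:R - 1) * e))%:E <=
  (kl_bound + (m%:R - 1) * e + (1 + c))%:E)%E.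
by rewrite lee_fin; lra.
Qed.

(** Summing over the m hypotheses, the probabilities of the disjoint events E
    under pure noise add up to at most 1. *)
Lemma fano_block (m : nat) (row : 'I_m -> 'I_d) (E : 'I_m -> set obs) :
  (0 < m)%N -> (forall l, measurable (E l)) -> trivIset [set: 'I_m] E ->
  ((ln m%:R)%:E * \sum_(l < m) \sum_(w : {ffun J -> bool})
      mu (shift_row (row l) (signed w) @^-1` E l) <=
   ((2 ^+ #|{: J}| * m%:R) * (kl_bound + 1))%:E)%E.
Proof.
move=> m0 mE tE; set p : R := 2 ^+ #|{: J}|.
have p0 : 0 <= p by rewrite exprn_ge0.
have m1 : 1 <= m%:R :> R by rewrite ler1n.
have m10 : 0 <= m%:R - 1 :> R by rewrite subr_ge0.
have lam0 : (0 <= (ln m%:R : R)%:E)%E by rewrite lee_fin ln_ge0.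
pose X l := (\int[mu]_x (\1_(E l) x * likelihood_ratio (row l) x)%:E)%E.
have X0 l : (0 <= X l)%E.
  apply: integral_ge0R => x; rewrite mulr_ge0 ?indicE ?ler0n//.
  exact/ltW/likelihood_ratio_gt0.
have rowE l : (\sum_(w : {ffun J -> bool})
    mu (shift_row (row l) (signed w) @^-1` E l) = p%:E * X l)%E.
  rewrite /X -random_signs_density//.
  apply: eq_bigr => w _.
  have mEw : measurable (shift_row (row l) (signed w) @^-1` E l).
    by rewrite -[X in measurable X]setTI; exact: measurable_shift_row.
  by rewrite -[in LHS](setIT (_ @^-1` _)) -integral_indic.
under eq_bigr do rewrite rowE.
rewrite -ge0_sume_distrr//.
rewrite muleCA ge0_sume_distrr//.
rewrite -mulrA EFinM; apply: lee_wpmul2l; first by rewrite lee_fin.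
apply: (@le_trans _ _ (\sum_(l < m) (kl_bound%:E + (m%:R - 1)%:E * mu (E l)))%E).
  by apply: lee_sum => l _; exact: likelihood_ratio_fano.
rewrite big_split /= sumEFin sumr_const card_ord.
have muE0 l : (0 <= mu (E l))%E by [].
rewrite -ge0_sume_distrr//.
apply: (@le_trans _ _ ((kl_bound *+ m)%:E + (m%:R - 1)%:E * 1)%E).
  apply: leeD2l; apply: lee_wpmul2l; first by rewrite lee_fin.
  rewrite -(iid_gaussian_setT mu_iid).
  have -> : (\sum_(l < m) mu (E l) = mu (\big[setU/set0]_(l < m) E l))%E.
    by rewrite measure_bigsetU_ord.
  by rewrite le_measure// inE//; exact: bigsetU_measurable.
rewrite mule1 -EFinD lee_fin -[kl_bound *+ m]mulr_natl.
by have := kl_bound_ge0; nra.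
Qed.
End random_signs.

(** * The block prior *)

Section resampling.
Context {I T : finType} {V : nmodType}.

Definition resample (f : {ffun I -> T}) (b : I) (t : T) : {ffun I -> T} :=
  [ffun i => if i == b then t else f i].

(** Exchanging the value of f at b with the new value t is an involution of the
    pairs (f, t).  In a uniform average, one coordinate may thus be drawn anew
    with the others fixed. *)
Lemma sum_resample (b : I) (F : {ffun I -> T} -> V) :
  \sum_f \sum_t F (resample f b t) = (\sum_f F f) *+ #|T|.
Proof.
rewrite pair_big /=.
pose h (p : {ffun I -> T} * T) := (resample p.1 b p.2, p.1 b).
have hK : involutive h.
  move=> [f t]; rewrite /h /=; congr pair.
    by apply/ffunP => i; rewrite !ffunE; case: eqP => // ->.
  by rewrite ffunE eqxx.
rewrite (reindex_inj (inv_inj hK)) /=.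
rewrite (eq_bigr (fun p => F p.1)); last first.
  by move=> [f t] _; congr F; apply/ffunP => i; rewrite !ffunE; case: eqP => // ->.
by rewrite -(pair_big predT predT (fun f (_ : T) => F f)) /= -sumrMnl;
   apply: eq_bigr => f _; rewrite sumr_const.
Qed.
End resampling.

Section noise_law.
Context {R : realType} {d : nat} (N : gaussian_noise R d).
Local Notation obs := (@obs_space R d).

Definition noise_obs (w : noise_space N) : obs := fun j k => noise_var N (j, k) w.

Lemma measurable_noise_obs : measurable_fun [set: noise_space N] noise_obs.
Proof. by apply: measurable_obs => j k; exact: measurable_funP. Qed.

HB.instance Definition _ :=
  isMeasurableFun.Build _ _ _ _ noise_obs measurable_noise_obs.

Definition noise_distribution : set obs -> \bar R :=
  distribution (noise_prob N) noise_obs.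

HB.instance Definition _ := Measure.on noise_distribution.

Lemma noise_distribution_iid : iid_gaussian noise_distribution.
Proof.
move=> J B mB.
have := @noise_indep _ _ N J B mB.
have -> : \bigcap_(i in [set` J]) noise_var N i @^-1` B i = noise_obs @^-1` box J B.
  apply/seteqP; split => w wB i iJ; have := wB i iJ;
  by rewrite /noise_obs /= -surjective_pairing.
rewrite /noise_distribution /distribution /pushforward => ->.
by apply: eq_bigr => i _; rewrite -(noise_law N i (mB i)).
Qed.

End noise_law.

Section minimax.
Context {R : realType}.

Lemma measurable_selector_tnth d (sel : obs_space d -> d.-tuple bool) (j : 'I_d) :
  selectors (R := R) sel ->
  measurable_fun [set: @obs_space R d] (fun y => tnth (sel y) j).
Proof. by move=> msel; exact: (measurableT_comp (measurable_tnth j) msel). Qed.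

Lemma hamming_ge0 d (a b : d.-tuple bool) : 0 <= hamming a b :> R.
Proof. exact: sumr_ge0. Qed.

Lemma measurable_hamming d (sel : obs_space d -> d.-tuple bool)
    (eta : d.-tuple bool) :
  selectors (R := R) sel ->
  measurable_fun [set: @obs_space R d] (fun y => hamming eta (sel y) : R).
Proof.
move=> msel; rewrite /hamming; apply: measurable_sum => j.
apply: (measurableT_comp
  (f := fun c : bool => `|(tnth eta j)%:R - c%:R| : R)) => //.
exact: measurable_selector_tnth.
Qed.

(** An observation with known mean; [base] will be either the whole signal or
    the part of it outside one block. *)
Definition observe {d} (eps : R) (base : 'I_d -> int -> R) (x : obs_space d) :
  obs_space d := fun j k => base j k + eps * x j k.

Lemma measurable_observe d (eps : R) (base : 'I_d -> int -> R) :
  measurable_fun [set: obs_space d] (observe eps base).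
Proof.
apply: measurable_obs => j k; apply: measurable_funD => //.
by apply: measurable_funM => //; exact: measurable_coord.
Qed.

Lemma expected_lossE d (N : gaussian_noise R d) (eps : R) (eta : d.-tuple bool)
    (theta : 'I_d -> int -> R) (sel : obs_space d -> d.-tuple bool) :
  selectors (R := R) sel ->
  (expected_loss N eps eta theta sel = \int[noise_distribution N]_x
     (hamming eta
       (sel (observe eps (fun j k => (tnth eta j)%:R * theta j k) x)))%:E)%E.
Proof.
move=> msel; rewrite /expected_loss unlock.
pose F (x : obs_space d) : R := hamming eta
  (sel (observe eps (fun j k => (tnth eta j)%:R * theta j k) x)).
have mF : measurable_fun [set: obs_space d] (fun x => (F x)%:E).
  apply/measurable_EFinP; apply: (measurableT_comp (measurable_hamming eta msel)).
  exact: measurable_observe.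
have := ge0_integral_pushforward (@measurable_noise_obs _ _ N) (noise_prob N)
  measurableT mF.
rewrite preimage_setT => -> // x _.
by rewrite lee_fin hamming_ge0.
Qed.

Section block_prior.
Variables (sigma : R) (d : nat) (N : gaussian_noise R d) (eps r : R).
Variables (s m : nat) (J : {fset int}) (v : int -> R).
Hypotheses (eps0 : 0 < eps) (s0 : (0 < s)%N) (m1 : (1 < m)%N).
Hypothesis smd : (s * m <= d)%N.
Hypothesis vTheta : forall w, Theta sigma r (signed (J := J) v w).

Local Notation obs := (@obs_space R d).
Local Notation mu := (noise_distribution N).
Local Notation pos := ('I_s * 'I_m)%type.
Local Notation choice := ('I_m * {ffun J -> bool})%type.
Local Notation config := {ffun 'I_s -> choice}.

Let card_pos : (#|{: pos}| <= d)%N.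
Proof. by rewrite card_prod !card_ord. Qed.

Definition place (x : pos) : 'I_d := widen_ord card_pos (enum_rank x).

Lemma place_inj : injective place.
Proof.
move=> x y /(congr1 val) /= e; apply: enum_rank_inj.
exact: val_inj.
Qed.

(** The d - s * m coordinates outside all blocks are mapped to [None]
    and stay inactive. *)
Definition unplace (j : 'I_d) : option pos := [pick x | place x == j].

Lemma placeK x : unplace (place x) = Some x.
Proof.
rewrite /unplace; case: pickP => [y /eqP/place_inj -> //|/(_ x)].
by rewrite eqxx.
Qed.

Lemma unplaceP j x : unplace j = Some x -> place x = j.
Proof. by rewrite /unplace; case: pickP => // y /eqP <- [->]. Qed.

Definition prior_eta (f : config) : d.-tuple bool :=
  [tuple if unplace j is Some (b, l) then l == (f b).1 else false | j < d].

(** The m rows of a block, active or not, carry the same signal: the supremum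
    in the risk asks for every row to be in Theta. *)
Definition prior_theta (f : config) (j : 'I_d) : int -> R :=
  signed v (if unplace j is Some (b, l) then (f b).2 else [ffun=> false]).

Lemma prior_eta_hypercube f : hypercube_s s (prior_eta f).
Proof.
rewrite /hypercube_s /=.
pose g (b : 'I_s) := place (b, (f b).1).
have gi : injective g by move=> b b' /place_inj [].
rewrite -[RHS]card_ord -(card_imset _ gi) -sum1_card [RHS]big_mkcond /=.
apply: eq_bigr => j _; rewrite tnth_mktuple.
case jE : (unplace j) => [[b l]|].
  have {}jE := unplaceP jE; case: eqP => [lE|lE].
    by rewrite (_ : j = g b) ?imset_f// /g -lE jE.
  case: ifP => // /imsetP[b' _]; rewrite -jE /g => /place_inj[bb' ll'].
  by case: lE; rewrite ll' bb'.
case: ifP => // /imsetP[b' _ jb']; move: jE.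
by rewrite jb' /g placeK.
Qed.

Lemma prior_theta_Theta f : Theta_d sigma r (prior_theta f).
Proof. by move=> j; exact: vTheta. Qed.

Definition prior_mean (f : config) (j : 'I_d) (k : int) : R :=
  (tnth (prior_eta f) j)%:R * prior_theta f j k.

Variable sel : obs -> d.-tuple bool.
Hypothesis msel : selectors sel.

Definition block_success (b : 'I_s) (l : 'I_m) : set obs :=
  [set y | forall l', tnth (sel y) (place (b, l')) = (l' == l)].

Lemma measurable_block_success b l : measurable (block_success b l).
Proof.
have -> : block_success b l = \bigcap_(l' in [set: 'I_m])
    ((fun y => tnth (sel y) (place (b, l'))) @^-1` [set l' == l]).
  by apply/seteqP; split => y yP l' => [_|]; apply: yP.
apply: fin_bigcap_measurable => // l' _.
by rewrite -[X in measurable X]setTI; exact: measurable_selector_tnth.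
Qed.

Lemma trivIset_block_success b : trivIset [set: 'I_m] (block_success b).
Proof.
apply/trivIsetP => l l' _ _ ll'; apply/seteqP; split => // y [/= yl yl'].
by have := yl l; rewrite yl' eqxx (negbTE ll').
Qed.

(** In a block where the selector does not name exactly the active coordinate,
    at least one of its m answers is wrong. *)
Lemma hamming_blocks f (y : obs) :
  s%:R <= hamming (prior_eta f) (sel y) +
    \sum_(b < s) \1_(block_success b (f b).1) y :> R.
Proof.
pose g j : R := `|(tnth (prior_eta f) j)%:R - (tnth (sel y) j)%:R|.
have g0 j : 0 <= g j by exact: normr_ge0.
apply: (@le_trans _ _ (\sum_(x : pos) g (place x) +
    \sum_(b < s) \1_(block_success b (f b).1) y)); last first.
  rewrite lerD2r /hamming (bigID (mem [set place x | x : pos])) /=.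
  rewrite big_imset /=; last by move=> x x' _ _; exact: place_inj.
  by rewrite lerDl sumr_ge0.
have -> : \sum_(x : pos) g (place x) = \sum_(b < s) \sum_(l < m) g (place (b, l)).
  by rewrite pair_bigA; apply: eq_bigr => -[].
rewrite -big_split /=.
rewrite -[X in X%:R <= _]card_ord -sumr_const; apply: ler_sum => b _.
rewrite indicE; have [/set_mem yb|yb] := boolP (y \in _).
  by rewrite lerDr sumr_ge0.
rewrite addr0; have [l lE] : exists l,
    tnth (sel y) (place (b, l)) <> (l == (f b).1).
  apply/existsNP => yP; move/negP: yb; apply; exact/mem_set.
rewrite (bigD1 l) //= -[leLHS]addr0; apply: lerD; last exact: sumr_ge0.
rewrite /g tnth_mktuple placeK; move: lE.
by case: (_ == _); case: (tnth _ _) => // _; rewrite ?subr0 ?sub0r ?normrN normr1.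
Qed.

Definition success_prob (b : 'I_s) (f : config) : R :=
  fine (mu (observe eps (prior_mean f) @^-1` block_success b (f b).1)).

Let mu_fin A : measurable A -> mu A \is a fin_num.
Proof.
move=> mA; rewrite ge0_fin_numE// (@le_lt_trans _ _ 1%E) ?ltry//.
by rewrite -(iid_gaussian_setT (noise_distribution_iid N)) le_measure// inE.
Qed.

Let measurable_success base b l :
  measurable (observe eps base @^-1` block_success b l).
Proof.
rewrite -[X in measurable X]setTI; apply: measurable_observe => //.
exact: measurable_block_success.
Qed.

(** Drawing the content of block b anew, the sum over that content is the one
    bounded by [fano_block], for the observations whose mean is fixed by the
    other blocks. *)
Lemma success_prob_block b :
  \sum_f success_prob b f <=
  #|{: config}|%:R * ((kl_bound J (fun k => v k / eps) + 1) / ln m%:R).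
Proof.
set D := kl_bound _ _ + 1.
have lnm : 0 < ln m%:R :> R by rewrite ln_gt0// ltr1n.
have card0 : (0 : R) < #|{: choice}|%:R.
  rewrite card_prod card_ord card_ffun card_bool ltr0n muln_gt0 expn_gt0 andbT.
  exact: ltnW.
rewrite mulrA ler_pdivlMr// -(ler_pM2l card0).
rewrite [leLHS]mulrA [X in X * _ <= _]mulr_natl -(sum_resample b) mulr_suml.
rewrite [leRHS]mulrCA [leRHS]mulr_natl -sumr_const; apply: ler_sum => f _.
have -> : \sum_(t : choice) success_prob b (resample f b t) =
    \sum_(l < m) \sum_(w : {ffun J -> bool}) success_prob b (resample f b (l, w)).
  by rewrite pair_bigA; apply: eq_bigr => -[].
(* The mean contributed by the blocks other than b. *)
pose base j k := if unplace j is Some (b', l') then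
  (if b' == b then 0 else (l' == (f b').1)%:R * signed v (f b').2 k) else 0.
pose E l := observe eps base @^-1` block_success b l.
have meanE l w : observe eps (prior_mean (resample f b (l, w))) =
    observe eps base \o
      shift_row (place (b, l)) (signed (J := J) (fun k => v k / eps) w).
  apply/funext => x; apply/funext => j; apply/funext => k.
  rewrite /= /observe /shift_row mulrDr addrA addrAC; congr (_ + _).
  rewrite /prior_mean tnth_mktuple /prior_theta /base.
  have signedE : eps * signed (J := J) (fun k => v k / eps) w k = signed v w k.
    rewrite /signed; case: insub => [i|]; last by rewrite mulr0.
    by rewrite mulrCA; congr (_ * _); rewrite mulrC divfK// gt_eqF.
  case jE : (unplace j) => [[b' l']|].
    rewrite -(unplaceP jE) (inj_eq place_inj) xpair_eqE ffunE.
    have [_|_] := eqVneq b' b; last by rewrite /= mulr0 addr0.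
    rewrite /=.
    rewrite add0r; case: eqP => _ /=; last by rewrite mul0r mulr0.
    by rewrite mul1r signedE.
  rewrite mul0r add0r; case: eqP => [jP|]; last by rewrite mulr0.
  by rewrite jP placeK in jE.
have mE l : measurable (E l) by exact: measurable_success.
have tE : trivIset [set: 'I_m] E.
  apply/trivIsetP => l l' _ _ ll'; rewrite /E -preimage_setI.
  by have /trivIsetP /(_ l l' I I ll') -> := @trivIset_block_success b;
     rewrite preimage_set0.
have := @fano_block _ _ _ (noise_distribution_iid N) J (fun k => v k / eps) m
  (fun l => place (b, l)) E (ltnW m1) mE tE.
have -> : (\sum_(l < m) \sum_(w : {ffun J -> bool})
    mu (shift_row (place (b, l)) (signed (J := J) (fun k => v k / eps)%R w)
      @^-1` E l) =
    (\sum_(l < m) \sum_(w : {ffun J -> bool})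
      success_prob b (resample f b (l, w)))%:E)%E.
  rewrite -sumEFin; apply: eq_bigr => l _; rewrite -sumEFin; apply: eq_bigr => w _.
  rewrite /success_prob ffunE eqxx meanE fineK//=.
  rewrite comp_preimage; apply: mu_fin.
  rewrite -[X in measurable X]setTI; apply: measurable_shift_row => //.
rewrite -EFinM lee_fin mulrC => /le_trans; apply.
by rewrite card_prod card_ord card_ffun card_bool natrM natrX [m%:R * _]mulrC.
Qed.

Lemma good_config : exists f : config,
  \sum_(b < s) success_prob b f <=
  s%:R * ((kl_bound J (fun k => v k / eps) + 1) / ln m%:R).
Proof.
set C := _ / _; apply/not_existsP => bad.
have : \sum_(b < s) \sum_f success_prob b f <=
    s%:R * (#|{: config}|%:R * C).
  rewrite mulr_natl -[X in _ *+ X]card_ord -sumr_const.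
  by apply: ler_sum => b _; exact: success_prob_block.
rewrite exchange_big /= mulrCA mulr_natl -sumr_const leNgt => /negP; apply.
have f0 : config := [ffun=> (Ordinal (ltnW m1), [ffun=> false])].
rewrite (bigD1 f0) //= [ltRHS](bigD1 f0) //=; apply: ltr_leD.
  by rewrite ltNge; apply/negP; exact: bad.
by apply: ler_sum => f _; rewrite leNgt; apply/negP => /ltW; exact: bad.
Qed.

Lemma selector_risk_ge : exists f : config,
  ((1 - (kl_bound J (fun k => (v k / eps)%R) + 1) / ln m%:R)%:E <=
   (s%:R^-1)%:E * expected_loss N eps (prior_eta f) (prior_theta f) sel)%E.
Proof.
have [f] := good_config; set C := _ / _ => fC; exists f.
rewrite expected_lossE//; set X := integral _ _ _.
have mh : measurable_fun [set: obs] (fun x => hamming (prior_eta f)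
    (sel (observe eps (prior_mean f) x)) : R).
  apply: (measurableT_comp (measurable_hamming _ msel)).
  exact: measurable_observe.
pose A b := observe eps (prior_mean f) @^-1` block_success b (f b).1.
have mA b : measurable (A b) by exact: measurable_success.
have mI b : measurable_fun [set: obs] (\1_(A b) : obs -> R).
  exact: measurable_indic.
have I0 b x : 0 <= \1_(A b) x :> R by rewrite indicE.
have : (s%:R%:E <= X + (\sum_(b < s) success_prob b f)%:E)%E.
  rewrite -(iid_gaussian_cst (noise_distribution_iid N) s%:R).
  rewrite -sumEFin.
  under eq_bigr => b _ do rewrite fineK ?mu_fin//
    -[X in mu X]setIT -integral_indic//.
  rewrite -integral_sum_ge0R// -integralD_ge0R//.
  - apply: le_integral_ge0R => //.
    + by apply: measurable_funD => //; exact: measurable_sum.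
    + by move=> x; exact: hamming_blocks.
  - exact: measurable_sum.
  - by move=> x; exact: hamming_ge0.
  - by move=> x; exact: sumr_ge0.
have X0 : (0 <= X)%E by apply: integral_ge0R => x; exact: hamming_ge0.
have s0' : (0 : R) < s%:R by rewrite ltr0n.
move: X0; case: X => [x x0|_ _|//]; last first.
  by rewrite gt0_muley ?leey// lte_fin invr_gt0.
rewrite -EFinD -EFinM !lee_fin => h.
rewrite mulrC ler_pdivlMr// mulrBl mul1r.
by rewrite lerBlDr (le_trans h)// lerD2l [C * _]mulrC.
Qed.

End block_prior.

(** Whatever the selector, its risk at some configuration of the prior is at
    least its average risk. *)
Theorem minimax_risk_ge (sigma : R) (d : nat) (N : gaussian_noise R d)
    (eps r : R) (s m : nat) (J : {fset int}) (v : int -> R) :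
  0 < eps -> (0 < s)%N -> (1 < m)%N -> (s * m <= d)%N ->
  (forall w, Theta sigma r (signed (J := J) v w)) ->
  ((1 - (kl_bound J (fun k => (v k / eps)%R) + 1) / ln m%:R)%:E <=
   minimax_risk sigma N eps s r)%E.
Proof.
move=> eps0 s0 m1 smd vTheta; apply: le_ereal_inf_tmp => _ [sel msel <-].
have [f /le_trans] := selector_risk_ge N J v eps0 s0 m1 smd msel; apply.
apply: ereal_sup_ge; exists (ereal_sup [set ((s%:R)^-1)%:E *
  expected_loss N eps (prior_eta smd f) theta sel | theta in Theta_d sigma r])%E.
  by exists (prior_eta smd f) => //; exact: prior_eta_hypercube.
apply: ereal_sup_ubound; exists (prior_theta v smd f) => //.
exact: (prior_theta_Theta smd vTheta).
Qed.

End minimax.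

(** * Signals with finite support *)

Section finite_support.
Context {R : realType}.
Implicit Types (g h v : int -> R) (A B F J : {fset int}).

Lemma ler_sum_fset A B h : (A `<=` B)%fset -> (forall k, 0 <= h k) ->
  \sum_(k <- A) h k <= \sum_(k <- B) h k.
Proof.
move=> AB h0.
rewrite (eq_big_seq (fun k => if k \in A then h k else 0)); last first.
  by move=> k ->.
rewrite (big_fset_incl _ AB); last by move=> k _ /negbTE ->.
by apply: ler_sum => k _; case: ifP.
Qed.

Lemma sum_le_esum F g : (forall k, 0 <= g k) ->
  ((\sum_(k <- F) g k)%:E <= \esum_(k in [set: int]) (g k)%:E)%E.
Proof.
move=> g0; apply: ereal_sup_ubound; exists [set` F] => //.
by rewrite -fsbig_seq ?fset_uniq// sumEFin.
Qed.

Lemma esum_le_sum g (x : \bar R) :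
  (forall F, ((\sum_(k <- F) g k)%:E <= x)%E) ->
  (\esum_(k in [set: int]) (g k)%:E <= x)%E.
Proof.
move=> gx; apply: ge_ereal_sup => _ [X [finX _] <-].
by rewrite fsbig_finite//= sumEFin.
Qed.

Lemma esum_gt_sum g (x : \bar R) :
  (x < \esum_(k in [set: int]) (g k)%:E)%E ->
  exists F, (x < (\sum_(k <- F) g k)%:E)%E.
Proof.
move=> /ereal_sup_gt[_ [X [finX _] <-]]; rewrite fsbig_finite//= sumEFin.
by exists (fset_set X).
Qed.

Lemma esum_fsupport J g : (forall k, 0 <= g k) ->
  (forall k, k \notin J -> g k = 0) ->
  \esum_(k in [set: int]) (g k)%:E = (\sum_(k <- J) g k)%:E.
Proof.
move=> g0 gJ; apply/eqP; rewrite eq_le sum_le_esum// andbT.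
apply: esum_le_sum => F; rewrite lee_fin.
apply: (le_trans (ler_sum_fset (fsubsetUl F J) g0)).
rewrite (big_fset_incl _ (fsubsetUr F J))// => k _; exact: gJ.
Qed.

Lemma sobolev_coef1_gt0 (sigma : R) : 0 < sobolev_coef sigma 1.
Proof. by rewrite powR_gt0// normr1 mulr1 mulr_gt0 ?pi_gt0. Qed.

Lemma sobolev_coef1_le (sigma : R) (k : int) : 0 < sigma -> k != 0 ->
  sobolev_coef sigma 1 <= sobolev_coef sigma k.
Proof.
move=> sigma0 k0; rewrite /sobolev_coef ge0_ler_powR ?(ltW sigma0)//.
- by rewrite nnegrE mulr_ge0// mulr_ge0 ?pi_ge0.
- by rewrite nnegrE mulr_ge0// mulr_ge0 ?pi_ge0.
- by rewrite ler_wpM2l ?mulr_ge0 ?pi_ge0// ler_int normr1 -gtz0_ge1 normr_gt0.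
Qed.

(** Keep v on a large finite set J containing 1 and put the missing energy
    q on frequency 1.  The energy is unchanged, the smoothness sum does not
    increase since frequency 1 has the smallest coefficient, and the sum of
    fourth powers changes by q (2 v_1^2 + q), which tends to 0 with q. *)
Lemma Theta_finite_support (sigma r M : R) v : 0 < sigma -> Theta sigma r v ->
  (\esum_(k in [set: int]) (v k ^+ 4)%:E < M%:E)%E ->
  exists J v', (forall w, Theta sigma r (signed (J := J) v' w)) /\
    \sum_(k <- J) v' k ^+ 4 < M.
Proof.
move=> sigma0 [v2oo v0 cv2 rv2] v4M.
have sq0 k : 0 <= v k ^+ 2 by rewrite sqr_ge0.
have qu0 k : 0 <= v k ^+ 4 by rewrite exprn_even_ge0.
have cs0 k : 0 <= sobolev_coef sigma k ^+ 2 * v k ^+ 2.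
  by rewrite mulr_ge0 ?sqr_ge0.
have [s2 s2E] : exists s2, \esum_(k in [set: int]) (v k ^+ 2)%:E = s2%:E.
  have : (0 <= \esum_(k in [set: int]) (v k ^+ 2)%:E)%E.
    by apply: esum_ge0 => k _; rewrite lee_fin.
  by case: (esum _ _) v2oo => // x _ _; exists x.
have [s4 s4E] : exists s4, \esum_(k in [set: int]) (v k ^+ 4)%:E = s4%:E.
  have : (0 <= \esum_(k in [set: int]) (v k ^+ 4)%:E)%E.
    by apply: esum_ge0 => k _; rewrite lee_fin.
  by case: (esum _ _) v4M => // x _ _; exists x.
have s2_ge F : \sum_(k <- F) v k ^+ 2 <= s2.
  by rewrite -lee_fin -s2E; apply: sum_le_esum.
have s4_ge F : \sum_(k <- F) v k ^+ 4 <= s4.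
  by rewrite -lee_fin -s4E; exact: sum_le_esum.
have s20 : 0 <= s2 by have := s2_ge fset0; rewrite big_seq_fset0.
have cv_le F : \sum_(k <- F) sobolev_coef sigma k ^+ 2 * v k ^+ 2 <= 1.
  by rewrite -lee_fin; apply: (le_trans _ cv2); exact: sum_le_esum.
rewrite s4E lte_fin in v4M.
(* Then the added fourth powers, at most tau (2 s2 + tau), stay below M - s4. *)
pose tau := Num.min 1 ((M - s4) / (2 * s2 + 2)).
have den0 : 0 < 2 * s2 + 2 by lra.
have tau0 : 0 < tau by rewrite lt_min ltr01 divr_gt0// subr_gt0.
have tau1 : tau <= 1 by rewrite ge_min lexx.
have tauM : tau * (2 * s2 + 2) <= M - s4.
  by rewrite -ler_pdivlMr// ge_min lexx orbT.
have [F s2F] : exists F, ((s2 - tau)%:E < (\sum_(k <- F) v k ^+ 2)%:E)%E.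
  by apply: esum_gt_sum; rewrite s2E lte_fin; lra.
rewrite lte_fin in s2F.
pose J := (1%Z |` F)%fset.
have J1 : (1 : int) \in J by rewrite !inE eqxx.
pose q := s2 - \sum_(k <- J) v k ^+ 2.
have q0 : 0 <= q by rewrite subr_ge0.
have qtau : q < tau.
  have : \sum_(k <- F) v k ^+ 2 <= \sum_(k <- J) v k ^+ 2.
    by apply: ler_sum_fset => //; exact: fsubsetU1.
  by rewrite /q; lra.
pose v' k := if k == 1 then Num.sqrt (v 1 ^+ 2 + q) else v k.
have v'1 : v' 1 ^+ 2 = v 1 ^+ 2 + q.
  by rewrite /v' eqxx sqr_sqrtr// addr_ge0.
have v'n k : k != 1 -> v' k = v k by rewrite /v' => /negbTE ->.
have split1 (G : int -> R -> R) : \sum_(k <- J) G k (v' k ^+ 2) =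
    \sum_(k <- J) G k (v k ^+ 2) + (G 1 (v 1 ^+ 2 + q) - G 1 (v 1 ^+ 2)).
  rewrite (bigD1_seq 1) ?fset_uniq//= [in RHS](bigD1_seq 1) ?fset_uniq//= v'1.
  rewrite (eq_bigr (fun k => G k (v k ^+ 2))); first by ring.
  by move=> k /v'n ->.
(* It is enough to compare finite sums: the energy outside J weighs at least
   c_1^2 times itself in the constraint. *)
have c1q : sobolev_coef sigma 1 ^+ 2 * q <=
    1 - \sum_(k <- J) sobolev_coef sigma k ^+ 2 * v k ^+ 2.
  set c := sobolev_coef sigma 1 ^+ 2; set S := \sum_(k <- J) _.
  have c0 : 0 < c by rewrite exprn_gt0// sobolev_coef1_gt0.
  rewrite mulrC -ler_pdivlMr// /q lerBlDr -lee_fin -s2E.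
  apply: esum_le_sum => F'; rewrite lee_fin -lerBlDr ler_pdivlMr//.
  pose H := (F' `|` J)%fset.
  have F'H : \sum_(k <- F') v k ^+ 2 <= \sum_(k <- H) v k ^+ 2.
    by apply: ler_sum_fset => //; exact: fsubsetUl.
  apply: (@le_trans _ _ ((\sum_(k <- H) v k ^+ 2 - \sum_(k <- J) v k ^+ 2) * c)).
    by rewrite ler_pM2r// lerB.
  rewrite lerBrDr; apply: (le_trans _ (cv_le H)).
  have diff0 k : 0 <= sobolev_coef sigma k ^+ 2 * v k ^+ 2 - v k ^+ 2 * c.
    rewrite subr_ge0; have [->|k0] := eqVneq k 0.
      by rewrite v0 expr0n /= mulr0 mul0r.
    rewrite mulrC ler_wpM2r// lerXn2r ?nnegrE ?powR_ge0//.
    exact: sobolev_coef1_le.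
  have := @ler_sum_fset J H _ (fsubsetUr F' J) diff0.
  by rewrite !sumrB -!mulr_suml -/S; lra.
exists J, v'; split; last first.
  have -> : \sum_(k <- J) v' k ^+ 4 = \sum_(k <- J) v k ^+ 4 +
      ((v 1 ^+ 2 + q) ^+ 2 - (v 1 ^+ 2) ^+ 2).
    have := split1 (fun _ y => y ^+ 2).
    by under eq_bigr do rewrite -exprM; under [in RHS]eq_bigr do rewrite -exprM.
  have v12 : v 1 ^+ 2 <= s2 by have := s2_ge [fset 1%Z]%fset; rewrite big_seq_fset1.
  have : (v 1 ^+ 2 + q) ^+ 2 - (v 1 ^+ 2) ^+ 2 = q * (2 * v 1 ^+ 2 + q) by ring.
  move=> ->; have := s4_ge J.
  have : q * (2 * v 1 ^+ 2 + q) < tau * (2 * s2 + 2).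
    have := sq0 1; move: (v 1 ^+ 2) v12 => u us2 u0.
    have : q * (2 * u + q) <= q * (2 * s2 + 1) by apply: ler_wpM2l; lra.
    have : q * (2 * s2 + 1) < tau * (2 * s2 + 2) by nra.
    lra.
  lra.
move=> w; set sv := signed v' w.
have sv2 k : sv k ^+ 2 = if k \in J then v' k ^+ 2 else 0.
  rewrite /sv /signed; case: insubP => [i -> <-|/negbTE ->].
    by rewrite exprMn sqrr_sign mul1r.
  by rewrite expr0n.
have esumJ (G : int -> R -> R) : (forall k y, 0 <= y -> 0 <= G k y) ->
    (forall k, G k 0 = 0) ->
    \esum_(k in [set: int]) (G k (sv k ^+ 2))%:E = (\sum_(k <- J) G k (v' k ^+ 2))%:E.
  move=> G0 G00; rewrite (@esum_fsupport J).
  - by congr EFin; apply: eq_big_seq => k kJ; rewrite sv2 kJ.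
  - by move=> k; apply: G0; exact: sqr_ge0.
  - by move=> k /negbTE kJ; rewrite sv2 kJ.
have sum2 : \esum_(k in [set: int]) (sv k ^+ 2)%:E = s2%:E.
  rewrite (esumJ (fun _ y => y))// (split1 (fun _ y => y)) /q.
  by congr EFin; ring.
split.
- by rewrite sum2 ltry.
- apply/eqP; rewrite -sqrf_eq0 sv2; case: ifP => // _.
  by rewrite v'n// v0 expr0n.
- rewrite (esumJ (fun k y => sobolev_coef sigma k ^+ 2 * y)).
  + rewrite lee_fin (split1 (fun k y => sobolev_coef sigma k ^+ 2 * y)).
    by rewrite -mulrBr [_ + q]addrC addrK; lra.
  + by move=> k y y0; rewrite mulr_ge0 ?sqr_ge0.
  + by move=> k; rewrite mulr0.
- by rewrite sum2 -s2E.
Qed.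

End finite_support.

(** * Asymptotics *)

Section asymptotics.
Context {R : realType}.

Lemma ln_divn_ge (d s : nat) : (0 < s)%N -> (s <= d)%N ->
  ln (d%:R / s%:R) - 1 <= ln (d %/ s)%:R :> R.
Proof.
move=> s0 sd; have m0 : (0 < d %/ s)%N by rewrite divn_gt0.
have m0R : 0 < (d %/ s)%:R :> R by rewrite ltr0n.
have s0R : 0 < s%:R :> R by rewrite ltr0n.
have d0R : 0 < d%:R :> R by rewrite ltr0n (leq_trans s0).
have ln2 : ln 2 <= 1 :> R.
  rewrite -[leRHS]expRK ler_ln ?posrE ?expR_gt0//.
  by have := expR_ge1Dx (1 : R); lra.
have : ln (d%:R / s%:R) <= ln (2 * (d %/ s)%:R) :> R.
  rewrite ler_ln ?posrE ?divr_gt0 ?mulr_gt0// ler_pdivrMr//.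
  rewrite -!natrM ler_nat mulnAC; apply: ltnW; apply: leq_trans (ltn_ceil d s0) _.
  by rewrite mulnAC leq_mul2r mul2n -addnn -addn1 leq_add2l m0 orbT.
by rewrite lnM ?posrE//; lra.
Qed.

(** For a fixed noise level.  With rho = (1 + c^2)/2, the bound of
    [minimax_risk_ge] is 1 - (rho l + 1) / (l - 1), which is at least
    (1 - c^2)/4 once l >= 8 / (1 - c^2). *)
Lemma minimax_risk_ge_ratio (sigma : R) (d : nat) (N : gaussian_noise R d)
    (eps r c : R) (s : nat) :
  0 < sigma -> 0 < eps -> (1 <= s <= d)%N -> 0 < c < 1 ->
  8 / (1 - c ^+ 2) <= ln (d%:R / s%:R) ->
  (u_fun sigma eps r / (Num.sqrt (2 * ln (d%:R / s%:R)))%:E <= c%:E)%E ->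
  (((1 - c ^+ 2) / 4)%:E <= minimax_risk sigma N eps s r)%E.
Proof.
move=> sigma0 eps0 /andP[s1 sd] /andP[c0 c1]; set l := ln (d%:R / s%:R) => lc uc.
have c21 : 0 < 1 - c ^+ 2 by rewrite subr_gt0 expr_lt1// ltW.
have cc : 0 < c ^+ 2 by rewrite exprn_gt0.
have l8 : 8 <= l * (1 - c ^+ 2) by rewrite -ler_pdivrMr.
have l0 : 8 <= l.
  by apply: le_trans lc; rewrite ler_pdivlMr// ler_piMr//; lra.
have e40 : 0 < eps ^+ 4 by rewrite exprn_gt0.
pose rho := (1 + c ^+ 2) / 2.
have I_le : (ereal_inf [set \esum_(k in [set: int]) (v k ^+ 4)%:E
    | v in Theta sigma r] <= (4 * eps ^+ 4 * c ^+ 2 * l)%:E)%E.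
  have sl : 0 < Num.sqrt (2 * l) by rewrite sqrtr_gt0; lra.
  move: uc; rewrite /u_fun inver gt_eqF// lee_pdivrMr// -EFinM.
  have -> : (c * Num.sqrt (2 * l))%:E = sqrte (c ^+ 2 * (2 * l))%:E.
    by rewrite /sqrte [in RHS]sqrtrM ?sqr_ge0// sqrtr_sqr ger0_norm// ltW.
  rewrite lee_sqrt; last by rewrite lee_fin mulr_ge0 ?ltW//; lra.
  rewrite lee_pdivrMl ?mulr_gt0// -EFinM => /le_trans; apply.
  by rewrite lee_fin le_eqVlt; apply/orP; left; apply/eqP; ring.
have [_ [v vT <-] v4] : exists2 y, [set \esum_(k in [set: int]) (v k ^+ 4)%:E
    | v in Theta sigma r] y & (y < (4 * eps ^+ 4 * rho * l)%:E)%E.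
  apply: ereal_inf_lt; apply: (le_lt_trans I_le).
  by rewrite lte_fin ltr_pM2r ?ltr_pM2l ?mulr_gt0 /rho//; lra.
have [J [v' [v'T v'4]]] := Theta_finite_support sigma0 vT v4.
have kl : kl_bound J (fun k => v' k / eps) <= rho * l.
  rewrite /kl_bound; have -> : \sum_(k <- J) (v' k / eps) ^+ 4 / 4 =
      (\sum_(k <- J) v' k ^+ 4) / (4 * eps ^+ 4).
    rewrite mulr_suml; apply: eq_bigr => k _.
    by field; rewrite gt_eqF.
  by rewrite ler_pdivrMr ?mulr_gt0//; lra.
have lnm := ln_divn_ge s1 sd; rewrite -/l in lnm.
have m1 : (1 < d %/ s)%N.
  rewrite ltnNge; apply/negP => m1.
  have : ln (d %/ s)%:R <= 0 :> R by rewrite ln_le0// lern1.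
  by lra.
apply: (le_trans _ (@minimax_risk_ge _ _ _ N _ _ _ _ J v' eps0 s1 m1 _ v'T)).
  rewrite lee_fin; set K := kl_bound _ _ in kl *.
  have lnm0 : 0 < ln (d %/ s)%:R :> R by lra.
  rewrite lerBrDr addrC -lerBrDr ler_pdivrMr//.
  have -> : 1 - (1 - c ^+ 2) / 4 = (3 + c ^+ 2) / 4 by field.
  apply: (@le_trans _ _ ((3 + c ^+ 2) / 4 * (l - 1))); last first.
    by rewrite ler_pM2l//; lra.
  by rewrite /rho in kl; nra.
by rewrite mulnC leq_divM.
Qed.
End asymptotics.

Unset Implicit Arguments.

Theorem theorem4 (R : realType) (sigma : R) (d s : R -> nat) (r : R -> R)
    (noise : forall eps : R, gaussian_noise R (d eps)) :
  0 < sigma ->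
  d eps @[eps --> 0^'+] --> \oo ->
  (fun eps : R => ln (d eps)%:R : R)
    =o_ (0^'+) (fun eps : R => eps `^ (- (2 / (2 * sigma + 1)))) ->
  (forall eps : R, 0 < eps -> (1 <= s eps <= d eps)%N) ->
  (fun eps : R => (s eps)%:R : R) =o_ (0^'+) (fun eps : R => (d eps)%:R : R) ->
  (forall eps : R, 0 < eps -> 0 < r eps) ->
  (limf_esup (fun eps : R => u_fun sigma eps (r eps) /
       (Num.sqrt (2 * ln ((d eps)%:R / (s eps)%:R)))%R%:E) 0^'+ < 1)%E ->
  (0 < limf_einf (fun eps : R =>
       minimax_risk sigma (noise eps) eps (s eps) (r eps)) 0^'+)%E.
Proof.
move=> sigma0 _ _ sd so _; rewrite limf_esupE => /ereal_inf_lt[_ [V V0 <-]] supV.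
have [c /andP[c0 c1] Vc] : exists2 c : R, 0 < c < 1 & forall eps, V eps ->
    (u_fun sigma eps (r eps) /
     (Num.sqrt (2 * ln ((d eps)%:R / (s eps)%:R)))%R%:E <= c%:E)%E.
  move: supV; set S := ereal_sup _ => S1.
  have ubS eps : V eps -> (u_fun sigma eps (r eps) /
      (Num.sqrt (2 * ln ((d eps)%:R / (s eps)%:R)))%R%:E <= S)%E.
    by move=> Veps; apply: ereal_sup_ubound; exists eps.
  case: S S1 ubS => [y|//|] y1 ubS; last first.
    exists (1 / 2); first by apply/andP; split; lra.
    by move=> eps /ubS /le_trans; apply; exact: leNye.
  rewrite lte_fin in y1; exists (Num.max y (1 / 2)).
    by rewrite lt_max gt_max y1; apply/andP; split; [apply/orP; right|]; lra.
  by move=> eps /ubS /le_trans; apply; rewrite lee_fin le_max lexx.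
pose L := 8 / (1 - c ^+ 2).
have near_sd : \forall eps \near (0 : R)^'+,
    `|(s eps)%:R : R| <= expR (- L) * `|(d eps)%:R : R|.
  by move/eqoP : so; apply; exact: expR_gt0.
have near_risk : \forall eps \near (0 : R)^'+,
    (((1 - c ^+ 2) / 4)%:E <= minimax_risk sigma (noise eps) eps (s eps) (r eps))%E.
  near=> eps.
  have eps0 : 0 < eps by near: eps; exact: nbhs_right_gt.
  have Veps : V eps by near: eps; exact: V0.
  have := sd eps eps0 => /andP[s1 _].
  have s0 : 0 < (s eps)%:R :> R by rewrite ltr0n.
  apply: minimax_risk_ge_ratio (Vc eps Veps) => //.
  - exact: sd.
  - by rewrite c0 c1.
  - have : (s eps)%:R <= expR (- L) * (d eps)%:R.
      rewrite -[leLHS]ger0_norm// -[(d eps)%:R]ger0_norm//.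
      by near: eps.
    rewrite -/L => h; rewrite -[leLHS]expRK ler_ln ?posrE ?expR_gt0//.
      by rewrite ler_pdivlMr// -ler_pdivlMl ?expR_gt0// -expRN.
    rewrite divr_gt0// ltr0n; have /andP[_] := sd eps eps0.
    exact: leq_trans.
rewrite limf_einfE; apply: (@lt_le_trans _ _ ((1 - c ^+ 2) / 4)%:E).
  by rewrite lte_fin divr_gt0// subr_gt0 expr_lt1// ltW.
apply: ereal_sup_ge; exists (ereal_inf [set minimax_risk sigma (noise eps) eps
    (s eps) (r eps) | eps in [set eps | (((1 - c ^+ 2) / 4)%:E <=
    minimax_risk sigma (noise eps) eps (s eps) (r eps))%E]]).
  by exists [set eps | (((1 - c ^+ 2) / 4)%:E <=
    minimax_risk sigma (noise eps) eps (s eps) (r eps))%E].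
by apply: le_ereal_inf_tmp => _ [eps h <-].
Unshelve. all: by end_near.
Qed.
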